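(* Consider a Riemannian game that is geodesically $\mu$-strongly monotone ($\mu>0$) and geodesically $\ell$-smooth on a manifold $\mathcal{M}=\prod_i\mathcal{M}_i$ without boundary that is complete under $d_{\mathcal{M}}$; in the stochastic setting assume in addition $d_{\mathcal{M}}(x^0,x^\star)\le B$ for the initial joint action $x^0$, where $x^\star$ is a Nash equilibrium. Let $\{x^t\}_{t=0}^T$ be generated by (deterministic or stochastic) Riemannian gradient descent with stepsizes $\eta_t>0$ and minibatch sizes $m_t\ge1$. Suppose that $\hat\mu,\hat\ell$ and $\eta_t$ satisfy $$0<\eta_t<\frac{2\hat\mu}{\hat\ell^2},\qquad 0<\hat\mu\le\frac{\mathbb{E}[\langle\Gamma_{x^{t+1}}^{x^t}F(x^{t+1})-F(x^t),-\eta_tg^t\rangle_{x^t}]}{\mathbb{E}[\|\eta_tg^t\|_{x^t}^2]}\le\sqrt{\frac{\mathbb{E}[\|\Gamma_{x^{t+1}}^{x^t}F(x^{t+1})-F(x^t)\|_{x^t}^2]}{\mathbb{E}[\|\eta_tg^t\|_{x^t}^2]}}\le\hat\ell .$$ Then $$\mathbb{E}[\|F(x^{t+1})\|_{x^{t+1}}^2]\le\left(1-\frac{2\eta_t\hat\mu-(\eta_t\hat\ell)^2}{2-2\eta_t\hat\mu+(\eta_t\hat\ell)^2}\right)\mathbb{E}[\|F(x^t)\|_{x^t}^2]+\frac{4\sigma^2}{m_t\eta_t(2\hat\mu-\eta_t\hat\ell^2)} .$$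
   Context: A Riemannian game consists of: a finite set of players $\mathcal{N}=\{1,\dots,N\}$; for each player $i$ a Riemannian manifold $\mathcal{M}_i$ (its action set); the joint action manifold $\mathcal{M}=\prod_{i\in\mathcal{N}}\mathcal{M}_i$ with the product Riemannian metric and Riemannian distance $d_{\mathcal{M}}$; and for each player $i$ a loss function $L_i:\mathcal{M}\to\mathbb{R}$. The operator is $F(x)=(\mathrm{grad}_{x_1}L_1(x),\dots,\mathrm{grad}_{x_N}L_N(x))\in T_x\mathcal{M}$, with Riemannian gradients taken with respect to each player's own action. A profile $x^\star$ is a Nash equilibrium if $L_i(x^\star)\le L_i(x_i,x_{-i}^\star)$ for all $i$ and all $x_i\in\mathcal{M}_i$. The game is geodesically $\mu$-strongly monotone and geodesically $\ell$-smooth if for every geodesic $\gamma:[0,1]\to\mathcal{M}$, with $\Gamma_{\gamma(1)}^{\gamma(0)}$ denoting parallel transport along $\gamma$, $$\langle\Gamma_{\gamma(1)}^{\gamma(0)}F(\gamma(1))-F(\gamma(0)),\dot\gamma(0)\rangle_{\gamma(0)}\ge\mu\|\dot\gamma(0)\|_{\gamma(0)}^2,\qquad \|F(\gamma(0))-\Gamma_{\gamma(1)}^{\gamma(0)}F(\gamma(1))\|_{\gamma(0)}\le\ell\|\dot\gamma(0)\|_{\gamma(0)} .$$ Riemannian gradient descent: given $x^0\in\mathcal{M}$, for $t=0,\dots,T-1$, query noisy estimators $g_i^t\in T_{x^t}\mathcal{M}$ of $F(x^t)$, $1\le i\le m_t$, that are (conditionally on $x^t$) independent and unbiased, $\mathbb{E}[g_i^t\mid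 x^t]=F(x^t)$, with variance $\mathbb{E}[\|g_i^t-F(x^t)\|_{x^t}^2\mid x^t]\le\sigma^2$; set $g^t=\frac1{m_t}\sum_{i=1}^{m_t}g_i^t$ and $x^{t+1}=\mathrm{Exp}_{x^t}(-\eta_tg^t)$. In the deterministic setting $g^t=F(x^t)$ and $\sigma=0$. $\Gamma_{x^{t+1}}^{x^t}$ is parallel transport from $x^{t+1}$ to $x^t$ along the geodesic $s\mapsto\mathrm{Exp}_{x^t}(-s\eta_tg^t)$, $s\in[0,1]$. *)

(* Defs.v *)
From HB Require Import structures.
From mathcomp Require Import all_boot all_order all_algebra.
From mathcomp Require Import all_classical all_reals all_analysis.

Set Implicit Arguments.
Unset Strict Implicit.
Unset Printing Implicit Defensive.

Import Order.TTheory GRing.Theory Num.Theory.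
Import numFieldNormedType.Exports.

Local Open Scope classical_set_scope.
Local Open Scope ring_scope.

(** * Riemannian manifolds

    Coordinate vectors are row vectors, so a change of coordinates acts on
    them by right multiplication with the library Jacobian ['J f p]. *)

(* Class C^k on O, then C^infinity: the directional derivatives along every
   constant vector are differentiable to all orders. *)
Fixpoint class_C (R : realType) (V W : normedModType R) (k : nat) (O : set V)
    (f : V -> W) : Prop :=
  if k is k'.+1 then
    (forall p, O p -> differentiable f p) /\
    (forall v, class_C k' O ('D_v f))
  else forall p, O p -> {for p, continuous f}.

Definition smooth_on (R : realType) (V W : normedModType R) (O : set V)
    (f : V -> W) : Prop :=
  forall k, class_C k O f.

(* A chart together with the local expression of the metric tensor in it:
   [metric c p] is the matrix (g_ij(p)), and [point c] inverts [coord c]. *)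
Record chart (R : realType) (n : nat) (M : topologicalType) := Chart {
  dom : set M;
  coord : M -> 'rV[R]_n;
  point : 'rV[R]_n -> M;
  metric : 'rV[R]_n -> 'M[R]_n
}.

Definition cod (R : realType) (n : nat) (M : topologicalType)
    (c : chart R n M) : set 'rV[R]_n :=
  coord c @` dom c.

Definition transition (R : realType) (n : nat) (M : topologicalType)
    (c d : chart R n M) : 'rV[R]_n -> 'rV[R]_n :=
  coord d \o point c.

(* [chart_at x] is a selected chart around [x]. A tangent vector at [x] is
   represented by its coordinates in that chart, so that T_x M is the type
   ['rV[R]_n] for every [x]; [to_chart] gives its coordinates in the other
   charts. The selection need not be continuous in [x]. *)
Record riemannianData (R : realType) (n : nat) (M : topologicalType) :=
  RiemannianData {
    atlas : set (chart R n M);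
    chart_at : M -> chart R n M
  }.

Section Geometry.
Variables (R : realType) (n : nat) (M : topologicalType).
Variable S : riemannianData R n M.

(* The charts are onto open subsets of R^n: there is no boundary. *)
Definition is_chart (c : chart R n M) : Prop :=
  [/\ open (dom c), open (cod c),
      (forall x, dom c x -> point c (coord c x) = x),
      {within dom c, continuous (coord c)} &
      {within cod c, continuous (point c)}].

Definition is_metric (c : chart R n M) : Prop :=
  [/\ smooth_on (cod c) (metric c),
      (forall p, cod c p -> (metric c p)^T = metric c p) &
      (forall p (v : 'rV[R]_n), cod c p -> v != 0 ->
         0 < (v *m metric c p *m v^T) 0 0)].

Definition riemannian_manifold : Prop :=
  [/\ hausdorff_space M /\ @second_countable M,
      (forall c, atlas S c -> is_chart c /\ is_metric c),
      (forall x, atlas S (chart_at S x) /\ dom (chart_at S x) x),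
      (forall c d, atlas S c -> atlas S d ->
         smooth_on (coord c @` (dom c `&` dom d)) (transition c d)) &
      (forall c d x, atlas S c -> atlas S d -> dom c x -> dom d x ->
         let J := 'J (transition c d) (coord c x) in
         metric c (coord c x) = J *m metric d (coord d x) *m J^T)].

Definition to_chart (x : M) (c : chart R n M) (v : 'rV[R]_n) : 'rV[R]_n :=
  v *m 'J (transition (chart_at S x) c) (coord (chart_at S x) x).

Definition inner (x : M) (v w : 'rV[R]_n) : R :=
  (v *m metric (chart_at S x) (coord (chart_at S x) x) *m w^T) 0 0.

Definition normsq (x : M) (v : 'rV[R]_n) : R := inner x v v.

Definition norm (x : M) (v : 'rV[R]_n) : R := Num.sqrt (normsq x v).

Definition differentiable_at (f : M -> R) (x : M) : Prop :=
  differentiable (f \o point (chart_at S x)) (coord (chart_at S x) x).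

(* (grad f)^k = g^{kj} d_j f, i.e. <grad f, v> = df(v) for all v. *)
Definition grad (f : M -> R) (x : M) : 'rV[R]_n :=
  let c := chart_at S x in
  (\row_(j < n) 'D_('e_j) (f \o point c) (coord c x))
    *m invmx (metric c (coord c x)).

(** ** Curves, geodesics, parallel transport

    Curves are total functions [R -> M]; only their restriction to [0, 1], or
    to an open interval around it when derivatives at the end points are
    needed, is relevant. *)

Definition curve_at (gamma : R -> M) (s : R) : Prop :=
  {for s, continuous gamma} /\
  (forall c, atlas S c -> dom c (gamma s) ->
     derivable (coord c \o gamma) s 1).

Definition velocity (gamma : R -> M) (s : R) : 'rV[R]_n :=
  derive1 (coord (chart_at S (gamma s)) \o gamma) s.

(* Gamma^k_ij of the Levi-Civita connection at the coordinate point [p]. *)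
Definition christoffel (c : chart R n M) (p : 'rV[R]_n) (k i j : 'I_n) : R :=
  let dg a b e := ('D_('e_a) (metric c) p) b e in
  2^-1 * \sum_l invmx (metric c p) k l * (dg i j l + dg j i l - dg l i j).

Definition christoffel_form (c : chart R n M) (p u v : 'rV[R]_n) : 'rV[R]_n :=
  \row_k \sum_i \sum_j christoffel c p k i j * u 0 i * v 0 j.

(* The covariant derivative of the field [V] along [gamma] vanishes at [s]:
   dV^k/ds = - Gamma^k_ij (dgamma^i/ds) V^j in every chart. *)
Definition parallel_at (gamma : R -> M) (V : R -> 'rV[R]_n) (s : R) : Prop :=
  forall c, atlas S c -> dom c (gamma s) ->
    is_derive s (1 : R) (fun r => to_chart (gamma r) c (V r))
      (- christoffel_form c (coord c (gamma s))
           (derive1 (coord c \o gamma) s) (to_chart (gamma s) c (V s))).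

(* Geodesics on [0, 1]; a solution of the geodesic equation on [0, 1] always
   extends to a slightly larger open interval. *)
Definition geodesic (gamma : R -> M) : Prop :=
  exists2 e : R, 0 < e & forall s, - e < s < 1 + e ->
    curve_at gamma s /\ parallel_at gamma (velocity gamma) s.

(* [u] is the parallel transport of [w] from T_(gamma 1) to T_(gamma 0) along
   [gamma], as a relation: the linear equation has a unique solution. *)
Definition transport (gamma : R -> M) (w u : 'rV[R]_n) : Prop :=
  exists V : R -> 'rV[R]_n,
    [/\ forall s, 0 <= s <= 1 -> parallel_at gamma V s, V 0 = u & V 1 = w].

(* [gamma s = Exp_x (s v)] for [0 <= s <= 1]; in particular
   [gamma 1 = Exp_x v]. *)
Definition exp_curve (x : M) (v : 'rV[R]_n) (gamma : R -> M) : Prop :=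
  [/\ geodesic gamma, gamma 0 = x & velocity gamma 0 = v].

(** ** Riemannian distance *)

Definition C1_curve (gamma : R -> M) : Prop :=
  exists2 e : R, 0 < e & forall s, - e < s < 1 + e ->
    curve_at gamma s /\
    (forall c, atlas S c -> dom c (gamma s) ->
       {for s, continuous (derive1 (coord c \o gamma))}).

Definition curve_length (gamma : R -> M) : \bar R :=
  (\int[lebesgue_measure]_(s in `[0%R, 1%R])
     (norm (gamma s) (velocity gamma s))%:E)%E.

(* [path_length x y l]: some piecewise C^1 curve from [x] to [y] has
   length [l]. *)
Inductive path_length : M -> M -> \bar R -> Prop :=
| path_length_C1 gamma of C1_curve gamma :
    path_length (gamma 0) (gamma 1) (curve_length gamma)
| path_length_cat x y z l l' of path_length x y l & path_length y z l' :
    path_length x z (l + l')%E.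

(* Equal to +oo for points in different connected components. *)
Definition rdist (x y : M) : \bar R := ereal_inf [set l | path_length x y l].

Definition metrically_complete : Prop :=
  forall u : nat -> M,
    (forall e : R, 0 < e -> exists K : nat, forall i j : nat,
       (K <= i)%N -> (K <= j)%N -> (rdist (u i) (u j) < e%:E)%E) ->
    exists y : M, forall e : R, 0 < e -> exists K : nat, forall i : nat,
      (K <= i)%N -> (rdist (u i) y < e%:E)%E.

(** ** Monotonicity and smoothness of a vector field *)

Definition strongly_monotone (F : M -> 'rV[R]_n) (mu : R) : Prop :=
  forall gamma u, geodesic gamma -> transport gamma (F (gamma 1)) u ->
    mu * normsq (gamma 0) (velocity gamma 0)
    <= inner (gamma 0) (u - F (gamma 0)) (velocity gamma 0).

Definition geodesically_smooth (F : M -> 'rV[R]_n) (ell : R) : Prop :=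
  forall gamma u, geodesic gamma -> transport gamma (F (gamma 1)) u ->
    norm (gamma 0) (F (gamma 0) - u)
    <= ell * norm (gamma 0) (velocity gamma 0).

(** ** Borel structures on M and on the tangent bundle TM

    TM is the type [M * 'rV[R]_n]. Its topology is not the product one: it is
    generated by the bundle charts (x, v) |-> (coord c x, to_chart x c v). *)

Definition M_borel : set (set M) := <<s [set A : set M | open A] >>.

Definition bundle_open : set (set (M * 'rV[R]_n)) :=
  [set A | exists c (O : set ('rV[R]_n * 'rV[R]_n)),
     [/\ atlas S c, open O &
         A = [set xv | dom c xv.1 /\
                       O (coord c xv.1, to_chart xv.1 c xv.2)]]].

Definition TM_borel : set (set (M * 'rV[R]_n)) := <<s bundle_open >>.

Definition borel_field (W : M -> 'rV[R]_n) : Prop :=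
  forall B, TM_borel B -> M_borel ((fun x => (x, W x)) @^-1` B).

Definition bounded_borel_on_TM (f : M * 'rV[R]_n -> R) : Prop :=
  (forall Y : set R, measurable Y -> TM_borel (f @^-1` Y)) /\
  (exists K : R, forall p, `|f p| <= K).

End Geometry.

(** * Product manifolds *)

Section Product.
Variables (R : realType) (N : nat) (dim : 'I_N -> nat).
Variable M : 'I_N -> topologicalType.

Definition prod_chart (c : forall i, chart R (dim i) (M i)) :
    chart R (\sum_i dim i) (prod_topology M) :=
  @Chart R (\sum_i dim i) (prod_topology M)
    [set x | forall i, dom (c i) (x i)]
    (fun x => \mxrow_(i < N) coord (c i) (x i))
    (fun p i => point (c i) (submxrow p i))
    (fun p => \mxdiag_(i < N) metric (c i) (submxrow p i)).

Definition prod_riemannian (S : forall i, riemannianData R (dim i) (M i)) :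
    riemannianData R (\sum_i dim i) (prod_topology M) :=
  RiemannianData
    [set prod_chart c | c in [set c | forall i, atlas (S i) (c i)]]
    (fun x => prod_chart (fun i => chart_at (S i) (x i))).

(** * Games *)

Variable S : forall i, riemannianData R (dim i) (M i).
Variable L : 'I_N -> prod_topology M -> R.

(* [dfwith x y] is the profile (y, x_{-i}) for [y : M i]. *)
Definition own_loss (i : 'I_N) (x : prod_topology M) (y : M i) : R :=
  L i (@dfwith 'I_N (fun j => M j) x i y).

Definition differentiable_game : Prop :=
  forall i (x : prod_topology M),
    differentiable_at (S i) (own_loss (i:=i) x) (x i).

Definition game_operator (x : prod_topology M) : 'rV[R]_(\sum_i dim i) :=
  \mxrow_(i < N) grad (S i) (own_loss (i:=i) x) (x i).

Definition nash_equilibrium (x : prod_topology M) : Prop :=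
  forall i (y : M i), L i x <= L i (@dfwith 'I_N (fun j => M j) x i y).

End Product.

(** * Stochastic oracles *)

Section Probability.
Variables (R : realType) (d : measure_display) (Omega : measurableType d).
Variable P : probability Omega R.

(* [Z] is a version of E[Y | G] for the sub-sigma-algebra [G]. *)
Definition condexp (G : set (set Omega)) (Y Z : Omega -> R) : Prop :=
  [/\ P.-integrable setT (EFin \o Y), P.-integrable setT (EFin \o Z),
      (forall B : set R, measurable B -> G (Z @^-1` B)) &
      (forall A, G A -> \int[P]_(w in A) (Z w)%:E
                        = \int[P]_(w in A) (Y w)%:E)%E].

Variables (n : nat) (M : topologicalType) (S : riemannianData R n M).

Definition sigma_of (x : Omega -> M) : set (set Omega) :=
  preimage_set_system setT x (@M_borel M).

(* [v w] is a tangent vector at the random point [x w], and (x, v) is a random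
   element of TM. *)
Definition random_tangent (x : Omega -> M) (v : Omega -> 'rV[R]_n) : Prop :=
  forall B, TM_borel S B -> measurable ((fun w => (x w, v w)) @^-1` B).

(* E[g | x] = F(x). The tangent space varies with the random point [x], so the
   conditional mean is tested against all bounded Borel vector fields. *)
Definition unbiased (F : M -> 'rV[R]_n) (x : Omega -> M)
    (g : Omega -> 'rV[R]_n) : Prop :=
  forall W, borel_field S W -> (forall y, norm S y (W y) <= 1) ->
    condexp (sigma_of x)
      (fun w => inner S (x w) (g w) (W (x w)))
      (fun w => inner S (x w) (F (x w)) (W (x w))).

(* E[ |g - F(x)|^2 | x ] <= sigma^2 almost surely. *)
Definition variance_le (F : M -> 'rV[R]_n) (x : Omega -> M)
    (g : Omega -> 'rV[R]_n) (sigma : R) : Prop :=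
  exists2 V : Omega -> R,
    condexp (sigma_of x) (fun w => normsq S (x w) (g w - F (x w))) V &
    {ae P, forall w, V w <= sigma ^+ 2}.

(* The g_i are mutually independent given [x]: conditional expectations of
   products of bounded Borel functions of the g_i factorize. Versions of a
   conditional expectation agree almost surely, so one family [q] suffices. *)
Definition cond_independent (m : nat) (x : Omega -> M)
    (g : nat -> Omega -> 'rV[R]_n) : Prop :=
  forall f : 'I_m -> M * 'rV[R]_n -> R,
    (forall i, bounded_borel_on_TM S (f i)) ->
    exists q : 'I_m -> Omega -> R,
      (forall i, condexp (sigma_of x) (fun w => f i (x w, g i w)) (q i)) /\
      condexp (sigma_of x)
        (fun w => \prod_(i < m) f i (x w, g i w))
        (fun w => \prod_(i < m) q i w).

Definition deterministic_oracle (F : M -> 'rV[R]_n) (T : nat)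
    (x : nat -> Omega -> M) (g : nat -> Omega -> 'rV[R]_n) : Prop :=
  forall t w, (t < T)%N -> g t w = F (x t w).

Definition stochastic_oracle (F : M -> 'rV[R]_n) (T : nat) (m : nat -> nat)
    (sigma : R) (x : nat -> Omega -> M) (g : nat -> Omega -> 'rV[R]_n) : Prop :=
  exists gs : nat -> nat -> Omega -> 'rV[R]_n, forall t, (t < T)%N ->
    [/\ (forall i, (i < m t)%N -> random_tangent (x t) (gs t i)),
        (forall i, (i < m t)%N -> unbiased F (x t) (gs t i)),
        (forall i, (i < m t)%N -> variance_le F (x t) (gs t i) sigma),
        cond_independent (m t) (x t) (gs t) &
        (forall w, g t w = (m t)%:R^-1 *: \sum_(i < m t) gs t i w)].

(* A run x^0, ..., x^T with directions [g t] and step sizes [eta t]; [u t] is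
   the transport of F(x^{t+1}) to T_{x^t} along s |-> Exp_{x^t}(- s eta_t g^t).
   The first two measurability clauses only express that the quantities whose
   expectations are taken are random variables. *)
Record rgd_run (F : M -> 'rV[R]_n) (T : nat) (x0 : M) (eta : nat -> R)
    (g : nat -> Omega -> 'rV[R]_n) (x : nat -> Omega -> M)
    (u : nat -> Omega -> 'rV[R]_n) : Prop := RgdRun {
  rgd_operator_random : forall t, (t <= T)%N ->
    random_tangent (x t) (fun w => F (x t w));
  rgd_transport_random : forall t, (t < T)%N -> random_tangent (x t) (u t);
  rgd_init : forall w, x 0%N w = x0;
  rgd_step : forall t w, (t < T)%N -> exists gamma : R -> M,
    [/\ exp_curve S (x t w) (- eta t *: g t w) gamma,
        gamma 1 = x t.+1 w &
        transport S gamma (F (x t.+1 w)) (u t w)]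
}.

End Probability.

(* Main.v *)
Require Import Defs.
From HB Require Import structures.
From mathcomp Require Import all_boot all_order all_algebra.
From mathcomp Require Import ring lra.
From mathcomp Require Import measurable_realfun.
From mathcomp Require Import all_classical all_reals all_analysis.

Import Defs.
Set Implicit Arguments.
Unset Strict Implicit.
Unset Printing Implicit Defensive.

Import Order.TTheory GRing.Theory Num.Theory.
Import numFieldNormedType.Exports.

Local Open Scope classical_set_scope.
Local Open Scope ring_scope.

(** The estimate is a computation with second moments in the tangent space at
    the current point [x t]. Write [F] for the operator at [x t], [u] for the
    operator at [x t.+1] transported back to [x t], [g] for the direction of the
    step, [delta = u - F] and [xi = g - F], so that [u = (g + delta) - xi].

    - Parallel transport is an isometry ([transport_isometry]), so [|u|] is the
      norm of the operator at [x t.+1].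
    - The two bounds on the ratios control [E<delta, g>] and [E|delta|^2] by
      [E|g|^2], and give [E|g + delta|^2 <= (1 - a) E|g|^2] for
      [a = 2 eta muh - (eta ellh)^2], which lies in ]0, 1].
    - Given [x t], the noise [xi] has mean zero and its summands are
      uncorrelated. Hence [E|g|^2 = E|F|^2 + E|xi|^2] and
      [E|xi|^2 <= sigma^2 / m] ([minibatch_noise]).
    - Young's inequality with weights [2 / (2 - a)] and [2 / a] bounds [E|u|^2]
      by [2 (1 - a) / (2 - a) E|F|^2] plus at most [4 / a E|xi|^2]; the first
      factor is the announced [1 - a / (2 - a)] ([descent]).

    Two points need care. Vectors at different points live in different tangent
    spaces, and conditional expectations of vectors are only given by testing
    against bounded Borel vector fields. A global Borel orthonormal frame
    ([borel_frame]) solves this: in coordinates along the frame all vectors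
    become finite families of real random variables, for which orthogonality to
    functions of the position ([Rintegral_condmean0]) and vanishing of the cross
    moments ([cross_moment0]) follow by truncation and dominated convergence.
    The frame exists without any global topology, since a manifold is covered by
    countably many charts and it may jump from one chart to the next.

    The geometry is needed on the product of the action manifolds, whose charts
    are the products of charts of the factors. Its metrics and Jacobians are
    block diagonal, and the properties of the factors that matter here pass to
    it ([prod_riemannian_C1]). *)

(** * Integrable and square-integrable random variables *)

Section SquareIntegrable.
Context d (Omega : measurableType d) (R : realType) (P : probability Omega R).

Implicit Types f g h : Omega -> R.

Definition integrableR (f : Omega -> R) : Prop :=
  P.-integrable setT (EFin \o f).

Lemma integrableR_measurable f : integrableR f -> measurable_fun setT f.
Proof. by move=> /measurable_int/measurable_EFinP. Qed.

Lemma integrableR_le f g : measurable_fun setT f -> integrableR g ->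
  (forall w, `|f w| <= `|g w|) -> integrableR f.
Proof.
move=> mf ig fg; apply: (le_integrable measurableT _ _ ig).
  exact/measurable_EFinP.
by move=> w _ /=; rewrite lee_fin.
Qed.

Lemma integrableRD f g : integrableR f -> integrableR g ->
  integrableR (fun w => f w + g w).
Proof. by move=> fi gi; exact: (integrableD measurableT fi gi). Qed.

Lemma integrableRB f g : integrableR f -> integrableR g ->
  integrableR (fun w => f w - g w).
Proof. by move=> fi gi; exact: (integrableB measurableT fi gi). Qed.

Lemma integrableRZ a f : integrableR f -> integrableR (fun w => a * f w).
Proof. by move=> fi; exact: (integrableZl measurableT a fi). Qed.

Lemma integrableR0 : integrableR (fun=> 0).
Proof. exact: integrable0 P setT. Qed.

Lemma integrableR_sum (I : Type) (s : seq I) (f : I -> Omega -> R) :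
  (forall i, integrableR (f i)) -> integrableR (fun w => \sum_(i <- s) f i w).
Proof.
move=> fi; elim: s => [|i s IH].
  by under [X in integrableR X]eq_fun do rewrite big_nil; exact: integrableR0.
by under [X in integrableR X]eq_fun do rewrite big_cons; exact: integrableRD.
Qed.

Lemma Rintegral_sum (I : Type) (s : seq I) (f : I -> Omega -> R) :
  (forall i, integrableR (f i)) ->
  \int[P]_w (\sum_(i <- s) f i w) = \sum_(i <- s) \int[P]_w f i w.
Proof.
move=> fi; elim: s => [|i s IH].
  rewrite big_nil; under eq_Rintegral do rewrite big_nil.
  by rewrite Rintegral_cst// mul0r.
rewrite big_cons -IH -RintegralD//; [|exact: fi|exact: integrableR_sum].
by under eq_Rintegral do rewrite big_cons.
Qed.

(** Dominated convergence in the form that removes truncations. *)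
Lemma Rintegral0_limit (f_ : nat -> Omega -> R) (f g : Omega -> R) :
  (forall n, measurable_fun setT (f_ n)) -> measurable_fun setT f -> integrableR g ->
  (forall n w, `|f_ n w| <= g w) -> (forall w, f_ n w @[n --> \oo] --> f w) ->
  (forall n, \int[P]_w f_ n w = 0) -> \int[P]_w f w = 0.
Proof.
move=> mf_ mf ig fg ff f0.
have [] := @dominated_convergence _ _ _ P setT measurableT
  (fun n => EFin \o f_ n) (EFin \o f) (EFin \o g).
- by move=> n; exact/measurable_EFinP.
- exact/measurable_EFinP.
- by apply: aeW => w _; apply: cvg_EFin; [exact: nearW|exact: ff].
- exact: ig.
- by apply: aeW => w n _ /=; rewrite lee_fin.
move=> intf _; rewrite (_ : (fun n => _) = fun=> 0%E); last first.
  apply/funext => n; have := f0 n; rewrite /Rintegral => f0n.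
  rewrite -[LHS]fineK ?f0n//; apply: integrable_fin_num => //.
  by apply: (integrableR_le (mf_ n) ig) => w; rewrite (le_trans (fg n w))// ler_norm.
by move=> /cvg_lim => /(_ (@ereal_hausdorff _)); rewrite /Rintegral lim_cst//= => <-.
Qed.

Definition sq_integrable (f : Omega -> R) : Prop :=
  measurable_fun setT f /\ integrableR (fun w => f w ^+ 2).

Lemma sq_integrableM f g : sq_integrable f -> sq_integrable g ->
  integrableR (fun w => f w * g w).
Proof.
move=> [mf f2] [mg g2]; apply: (integrableR_le _ (integrableRD f2 g2)).
  exact: measurable_funM.
move=> w; rewrite (ger0_norm (addr_ge0 (sqr_ge0 _) (sqr_ge0 _))) normrM.
rewrite -(real_normK (num_real (f w))) -(real_normK (num_real (g w))).
set a := `|f w|; set b := `|g w|.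
have : 0 <= (a - b) ^+ 2 + a ^+ 2 + b ^+ 2 by rewrite !addr_ge0// sqr_ge0.
rewrite sqrrB => h; rewrite -(@ler_pM2r _ 2)//; nra.
Qed.
End SquareIntegrable.

(** * Conditioning on a sub-sigma-algebra *)

Section Conditioning.
Context d (Omega : measurableType d) (R : realType) (P : probability Omega R).
Implicit Types f g h : Omega -> R.

Lemma Rintegral_indic (A : set Omega) (f : Omega -> R) :
  \int[P]_(w in A) f w = \int[P]_w (\1_A w * f w).
Proof.
rewrite Rintegral_mkcond; apply: eq_Rintegral => w _.
by rewrite patchE indicE; case: ifP => _; rewrite ?mul1r ?mul0r.
Qed.

Variable G : set (set Omega).
Hypotheses (sigG : sigma_algebra setT G) (subG : G `<=` measurable).

(** Stated on preimages, as in [condexp]; [measurable_wrtE] relates it to the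
    measurable type that [G] generates. *)
Definition measurable_wrt (h : Omega -> R) : Prop :=
  forall B : set R, measurable B -> G (h @^-1` B).

Lemma measurable_wrtE h : measurable_wrt h <->
  @measurable_fun _ _ (g_sigma_algebraType G) R setT h.
Proof.
rewrite /measurable_wrt; split => [hG _ B mB|hG B mB].
  by rewrite setTI measurable_g_measurableTypeE//; exact: hG.
have := hG measurableT _ mB.
by rewrite setTI measurable_g_measurableTypeE.
Qed.

Lemma measurable_wrt_measurable h : measurable_wrt h -> measurable_fun setT h.
Proof. by move=> hG _ B mB; rewrite setTI; exact/subG/hG. Qed.

(** The integrable functions whose conditional expectation given [G] is 0. *)
Definition condmean0 (f : Omega -> R) : Prop :=
  integrableR P f /\ forall A, G A -> \int[P]_(w in A) f w = 0.

Import HBNNSimple.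

(** A simple function for [G] is a combination of indicators of sets of [G]. *)
Lemma Rintegral_sfun_condmean0 (Z : Omega -> R) (Znull : condmean0 Z)
  (phi : {nnsfun (g_sigma_algebraType G) >-> R}) :
  \int[P]_w (phi w * Z w) = 0.
Proof.
have [iZ Z0] := Znull.
have Gphi y : G (phi @^-1` [set y]).
  have := measurable_sfunP phi (measurable_set1 y).
  by rewrite measurable_g_measurableTypeE.
under eq_Rintegral => w _.
  rewrite fimfunE fsbig_finite//= mulr_suml.
  over.
rewrite Rintegral_sum => [|y].
  rewrite big1// => y _.
  under eq_Rintegral do rewrite -mulrA.
  rewrite RintegralZl//; first by rewrite -Rintegral_indic Z0 ?mulr0.
  apply: (integrableR_le _ iZ).
    apply: measurable_funM; last exact: integrableR_measurable iZ.
    exact/measurable_indic/subG.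
  move=> w; rewrite normrM ler_piMl// indicE.
  by case: (_ \in _); rewrite ?normr1 ?normr0.
apply: (integrableR_le _ (integrableRZ y iZ)).
  apply: measurable_funM; last exact: integrableR_measurable iZ.
  by apply: measurable_funM => //; exact/measurable_indic/subG.
move=> w; rewrite !normrM ler_wpM2r// ler_piMr// indicE.
by case: (_ \in _); rewrite ?normr1 ?normr0.
Qed.

Lemma Rintegral_ge0_condmean0 Z h : condmean0 Z -> measurable_wrt h ->
  (forall w, 0 <= h w) -> integrableR P (fun w => h w * Z w) ->
  \int[P]_w (h w * Z w) = 0.
Proof.
move=> nZ hG h0 ihZ.
have mh : @measurable_fun _ _ (g_sigma_algebraType G) _ setT (EFin \o h).
  by apply/measurable_EFinP/measurable_wrtE.
pose phi := nnsfun_approx measurableT mh.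
have mphi n : measurable_fun setT (phi n : Omega -> R).
  apply/measurable_wrt_measurable/measurable_wrtE; exact: measurable_funP.
have mZ : measurable_fun setT Z by case: nZ => /integrableR_measurable.
have phih w : phi n w @[n --> \oo] --> h w.
  have H := @cvg_nnsfun_approx _ _ _ _ measurableT _ mh
    (fun x _ => h0 x : (0 <= (EFin \o h) x)%E) w I.
  by move/fine_cvgP : H => [].
have phile n w : phi n w <= h w.
  rewrite /phi nnsfun_approxE -lee_fin.
  by apply: (@le_approx _ _ _ _ _ n w) => // x _; rewrite /= lee_fin.
apply: (@Rintegral0_limit _ _ _ P (fun n w => phi n w * Z w) _
  (fun w => `|h w * Z w|)).
- by move=> n; exact: measurable_funM.
- exact: integrableR_measurable ihZ.
- apply: (integrableR_le _ ihZ) => [|w]; last by rewrite normr_id.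
  by apply: measurableT_comp => //; exact: integrableR_measurable ihZ.
- move=> n w; rewrite !normrM ler_wpM2r// !ger0_norm//.
- by move=> w; apply: cvgMl; exact: phih.
- by move=> n; exact: Rintegral_sfun_condmean0.
Qed.

(** Simple functions for [G] increase to the positive and the negative part of
    [h], and their products with [Z] are dominated by [`|h * Z|]. Hence [h] may
    be unbounded, as long as [h * Z] is integrable. *)
Lemma Rintegral_condmean0 Z h : condmean0 Z -> measurable_wrt h ->
  integrableR P (fun w => h w * Z w) -> \int[P]_w (h w * Z w) = 0.
Proof.
move=> nZ hG ihZ; have mZ := integrableR_measurable nZ.1.
have mhG := (measurable_wrtE h).1 hG.
have part (h1 : Omega -> R) : measurable_wrt h1 -> (forall w, 0 <= h1 w) ->
    (forall w, `|h1 w| <= `|h w|) ->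
    integrableR P (fun w => h1 w * Z w) /\ \int[P]_w (h1 w * Z w) = 0.
  move=> h1G h10 h1h; suff ih1 : integrableR P (fun w => h1 w * Z w).
    by split => //; exact: Rintegral_ge0_condmean0.
  apply: (integrableR_le _ ihZ) => [|w]; last by rewrite !normrM ler_wpM2r.
  by apply: measurable_funM => //; exact: measurable_wrt_measurable.
have [] := part (h^\+).
- exact/measurable_wrtE/measurable_funrpos.
- by move=> w; exact: funrpos_ge0.
- move=> w; rewrite ger0_norm ?funrpos_ge0// /funrpos ge_max normr_ge0.
  by rewrite ler_norm.
move=> ip ep; have [] := part (h^\-).
- exact/measurable_wrtE/measurable_funrneg.
- by move=> w; exact: funrneg_ge0.
- move=> w; rewrite ger0_norm ?funrneg_ge0// /funrneg ge_max normr_ge0.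
  by rewrite -normrN ler_norm.
move=> im em.
have -> : \int[P]_w (h w * Z w) = \int[P]_w (h^\+ w * Z w - h^\- w * Z w).
  apply: eq_Rintegral => w _; rewrite -mulrBl; congr (_ * _).
  by rewrite -[in LHS](funrposBneg h).
by rewrite RintegralB// ep em subr0.
Qed.

Lemma condexp_integrableR Y Z :
  condexp P G Y Z -> integrableR P Y /\ integrableR P Z.
Proof. by case. Qed.

Lemma condexp_measurable_wrt Y Z : condexp P G Y Z -> measurable_wrt Z.
Proof. by case. Qed.

Lemma condexp_residual Y Z : condexp P G Y Z -> condmean0 (fun w => Y w - Z w).
Proof.
move=> [iY iZ _ YZ]; split; first exact: integrableRB.
move=> A GA; have mA := subG GA.
rewrite RintegralB//; [|exact: integrableS iY|exact: integrableS iZ].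
by rewrite /Rintegral YZ// subrr.
Qed.

Lemma measurable_wrt_indic (A : set Omega) : G A ->
  @measurable_fun _ _ (g_sigma_algebraType G) R setT \1_A.
Proof.
move=> GA; apply: measurable_indic.
by rewrite measurable_g_measurableTypeE.
Qed.

(** Testing [f] against its own sign gives the integral of [`|f|]. *)
Lemma condmean0_measurable_eq0 f : condmean0 f -> measurable_wrt f ->
  {ae P, forall w, f w = 0}.
Proof.
move=> nf fG; have [iff _] := nf; have mf := integrableR_measurable iff.
(* the sign of [f], with value 1 where [f] vanishes *)
pose s (w : Omega) : R := 2 * \1_(f @^-1` [set y | 0 <= y]) w - 1.
have sE w : s w * f w = `|f w|.
  rewrite /s indicE; case: (leP 0 (f w)) => f0.
    by rewrite mem_set//= (ger0_norm f0); ring.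
  rewrite memNset/= ?(ltr0_norm f0); last by apply/negP; rewrite -ltNge.
  by ring.
have sG : measurable_wrt s.
  apply/measurable_wrtE; apply: measurable_funB => //; apply: measurable_funM => //.
  apply: measurable_wrt_indic; apply: fG.
  have -> : [set y : R | 0 <= y] = `[0, +oo[%classic by rewrite set_itvE.
  exact: measurable_itv.
have isf : integrableR P (fun w => s w * f w).
  apply: (integrableR_le _ iff) => [|w]; last by rewrite sE normr_id.
  by apply: measurable_funM => //; exact: measurable_wrt_measurable.
have := Rintegral_condmean0 nf sG isf.
rewrite /Rintegral; under eq_integral do rewrite sE -abse_EFin.
move=> f0; have /integrableP[_ foo] := iff.
have : (\int[P]_w `|(EFin \o f) w| = 0)%E.
  by rewrite -[LHS]fineK ?f0// ge0_fin_numE ?integral_ge0.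
move/ae_eq_integral_abs => /(_ measurableT) H.
have /H : measurable_fun setT (EFin \o f) by exact/measurable_EFinP.
by apply: filterS => w /(_ I) [].
Qed.

Lemma condexp_unique Y Z Z' : condexp P G Y Z -> condexp P G Y Z' ->
  {ae P, forall w, Z w = Z' w}.
Proof.
move=> h h'; have [iY iZ] := condexp_integrableR h.
have [_ iZ'] := condexp_integrableR h'.
have : {ae P, forall w, Z w - Z' w = 0}.
  apply: condmean0_measurable_eq0.
    split; first exact: integrableRB.
    move=> A GA; have mA := subG GA.
    rewrite RintegralB//; [|exact: integrableS iZ|exact: integrableS iZ'].
    case: h => _ _ _ ZY; case: h' => _ _ _ ZY'.
    by rewrite /Rintegral ZY// ZY'// subrr.
  apply/measurable_wrtE/measurable_funB; apply/measurable_wrtE.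
    exact: condexp_measurable_wrt h.
  exact: condexp_measurable_wrt h'.
by apply: filterS => w /eqP; rewrite subr_eq0 => /eqP.
Qed.

Lemma condexp_cst (c : R) : condexp P G (cst c) (cst c).
Proof.
split => //; try exact: finite_measure_integrable_cst.
by apply: (measurable_wrtE (cst c)).2; exact: measurable_cst.
Qed.

Definition clamp (K x : R) : R := Num.max (- K) (Num.min K x).

Lemma measurable_clamp K : measurable_fun setT (clamp K).
Proof. by apply: measurable_maxr => //; apply: measurable_minr. Qed.

Lemma clamp_bound K x : 0 <= K -> `|clamp K x| <= K.
Proof.
move=> K0; rewrite /clamp ler_norml le_max lexx/= ge_max ge_min lexx/= andbT.
by rewrite (le_trans _ K0)// oppr_le0.
Qed.

Lemma clamp_le K x : 0 <= K -> `|clamp K x| <= `|x|.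
Proof.
move=> K0; rewrite /clamp; have [xK|Kx] := leP x K.
  have [Kx|xK'] := leP (- K) x => //.
  rewrite normrN ger0_norm// ltr0_norm; first by rewrite lerNr ltW.
  by rewrite (lt_le_trans xK')// oppr_le0.
rewrite max_r; last by rewrite (le_trans _ K0)// oppr_le0.
by rewrite ger0_norm// (le_trans (ltW Kx))// ler_norm.
Qed.

Lemma clamp_cvg x : clamp n%:R x @[n --> \oo] --> x.
Proof.
apply: cvg_near_cst; near=> n.
have : `|x| <= n%:R by near: n; exact: nbhs_infty_ger.
by rewrite ler_norml => /andP[? ?]; rewrite /clamp min_r// max_r.
Unshelve. all: by end_near. Qed.
End Conditioning.

(** * Conditionally independent variables are uncorrelated *)

Section Cross.
Context d (Omega : measurableType d) (R : realType) (P : probability Omega R).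
Implicit Types f g h : Omega -> R.
Variable G : set (set Omega).
Hypotheses (sigG : sigma_algebra setT G) (subG : G `<=` measurable).

Lemma integrableR_bounded f g (K : R) : measurable_fun setT f -> integrableR P g ->
  (forall w, `|f w| <= K) -> integrableR P (fun w => f w * g w).
Proof.
move=> mf ig fK; apply: (integrableR_le _ (integrableRZ K ig)).
  by apply: measurable_funM => //; exact: integrableR_measurable ig.
move=> w; rewrite !normrM ler_wpM2r// (le_trans (fK w))//.
by rewrite ler_norm.
Qed.

Lemma Rintegral_ae_eq f g : measurable_fun setT f -> measurable_fun setT g ->
  {ae P, forall w, f w = g w} -> \int[P]_w f w = \int[P]_w g w.
Proof.
move=> mf mg fg; rewrite /Rintegral; congr fine; apply: ae_eq_integral => //.
- exact/measurable_EFinP.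
- exact/measurable_EFinP.
- by apply: filterS fg => w ->.
Qed.

Lemma indic_le1 (A : set Omega) w : `|\1_A w| <= 1 :> R.
Proof. by rewrite indicE; case: (_ \in _); rewrite ?normr1 ?normr0. Qed.

Lemma condexp_ae_eq Y Z Z' : condexp P G Y Z -> measurable_wrt G Z' ->
  {ae P, forall w, Z w = Z' w} -> condexp P G Y Z'.
Proof.
move=> [iY iZ GZ ZY] GZ' ZZ'.
have mZ := integrableR_measurable iZ.
have mZ' := measurable_wrt_measurable subG GZ'.
split => //.
- have /integrableP[_ foo] := iZ.
  apply/integrableP; split; first exact/measurable_EFinP.
  rewrite (le_lt_trans _ foo)// le_eqVlt; apply/orP; left; apply/eqP.
  apply: ae_eq_integral => //.
  + by apply/measurableT_comp => //; exact/measurable_EFinP.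
  + by apply/measurableT_comp => //; exact/measurable_EFinP.
  + by apply: filterS ZZ' => w /= ->.
- move=> B GB; rewrite -ZY//; apply: ae_eq_integral.
  + exact: subG.
  + by apply/measurable_EFinP; exact: measurable_funS mZ'.
  + by apply/measurable_EFinP; exact: measurable_funS mZ.
  + by apply: filterS ZZ' => w /= ->.
Qed.

(** Conditional independence replaces [clamp K X] by its conditional mean [q]
    when it is integrated against a clamped [Y], and then, in the limit, against
    [Y] itself; finally [Y] is replaced by its own conditional mean [Psi]. As
    [q] is only known to be integrable, this is done on the events where it is
    at most [k], and then [k] goes to infinity. *)
Lemma cross_truncated (X Y Psi q : Omega -> R) (K : R) : 0 <= K ->
  measurable_fun setT X ->
  condexp P G Y Psi -> condexp P G (fun w => clamp K (X w)) q ->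
  (forall n : nat, exists r, condexp P G (fun w => clamp n%:R (Y w)) r /\
     condexp P G (fun w => clamp K (X w) * clamp n%:R (Y w))
                 (fun w => q w * r w)) ->
  \int[P]_w (clamp K (X w) * (Y w - Psi w)) = 0.
Proof.
move=> K0 mX cY cq ind.
have [iY iPsi] := condexp_integrableR cY.
have [iX iq] := condexp_integrableR cq.
have mY := integrableR_measurable iY; have mPsi := integrableR_measurable iPsi.
have mcX := integrableR_measurable iX; have mq := integrableR_measurable iq.
have nX := condexp_residual subG cq; have nY := condexp_residual subG cY.
have qG := condexp_measurable_wrt cq; have PsiG := condexp_measurable_wrt cY.
pose A (k : nat) := q @^-1` `[- k%:R, k%:R].
have GA k : G (A k) by apply: qG; exact: measurable_itv.
have mA k : measurable (A k) by exact/subG/GA.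
have m1 k : measurable_fun setT (\1_(A k) : Omega -> R).
  exact: measurable_indic.
have qA k w : `|\1_(A k) w * q w| <= k%:R.
  rewrite indicE; have [|_] := boolP (w \in A k); last first.
    by rewrite mul0r normr0.
  by rewrite inE /A/= in_itv/= mul1r ler_norml.
have XqA k w : `|\1_(A k) w * (clamp K (X w) - q w)| <= K + k%:R.
  rewrite mulrBr (le_trans (ler_normB _ _))// lerD//.
  by rewrite normrM (le_trans (ler_piMl _ (indic_le1 _ _)))// clamp_bound.
have mXq k : measurable_fun setT (fun w => \1_(A k) w * (clamp K (X w) - q w)).
  by apply: measurable_funM => //; exact: measurable_funB.
have step1 k n :
    \int[P]_w (\1_(A k) w * (clamp K (X w) - q w) * clamp n%:R (Y w)) = 0.
  have [r [cr cqr]] := ind n.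
  have [icY ir] := condexp_integrableR cr.
  have [iXY iqr] := condexp_integrableR cqr.
  have mr := integrableR_measurable ir.
  have mcY := integrableR_measurable icY.
  have icYq : integrableR P (fun w => clamp n%:R (Y w) * q w).
    by apply: (integrableR_bounded (K := n%:R)) => // w; exact: clamp_bound.
  have nXY := condexp_residual subG cqr.
  have nYr := condexp_residual subG cr.
  have e1 : \int[P]_w (\1_(A k) w *
      (clamp K (X w) * clamp n%:R (Y w) - q w * r w)) = 0.
    by have [_ /(_ _ (GA k))] := nXY; rewrite Rintegral_indic.
  have i2 : integrableR P (fun w => \1_(A k) w * q w * (clamp n%:R (Y w) - r w)).
    apply: (integrableR_bounded (K := k%:R)) => //; last by case: nYr.
    exact: measurable_funM.
  have e2 : \int[P]_w (\1_(A k) w * q w * (clamp n%:R (Y w) - r w)) = 0.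
    apply: (Rintegral_condmean0 sigG subG nYr _ i2).
    apply/(measurable_wrtE sigG); apply: measurable_funM.
      exact: (measurable_wrt_indic sigG (GA k)).
    exact/(measurable_wrtE sigG).
  transitivity (0 - 0 : R); last by rewrite subr0.
  rewrite -[X in _ = X - _]e1 -[X in _ = _ - X]e2 -RintegralB//.
    by apply: eq_Rintegral => w _; ring.
  by apply: (integrableR_bounded (K := 1)); [|case: nXY|exact: indic_le1].
have step2 k : \int[P]_w (\1_(A k) w * (clamp K (X w) - q w) * Y w) = 0.
  apply: (@Rintegral0_limit _ _ _ P
    (fun n w => \1_(A k) w * (clamp K (X w) - q w) * clamp n%:R (Y w)) _
    (fun w => (K + k%:R) * `|Y w|)).
  - move=> n; apply: measurable_funM => //.
    by apply: measurableT_comp mY; exact: measurable_clamp.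
  - exact: measurable_funM.
  - apply: integrableRZ; apply: (integrableR_le _ iY) => [|w]; last by rewrite normr_id.
    exact: measurableT_comp.
  - by move=> n w; rewrite normrM ler_pM// clamp_le.
  - by move=> w; apply: cvgMr; exact: clamp_cvg.
  - exact: step1.
have step3 k : \int[P]_w (\1_(A k) w * (clamp K (X w) * (Y w - Psi w))) = 0.
  have iA1 : integrableR P (fun w => \1_(A k) w * (clamp K (X w) - q w) * Y w).
    exact: (integrableR_bounded (K := K + k%:R)).
  have iA2 : integrableR P (fun w => \1_(A k) w * q w * (Y w - Psi w)).
    apply: (integrableR_bounded (K := k%:R)) => //; last by case: nY.
    exact: measurable_funM.
  have iA3 : integrableR P (fun w => \1_(A k) w * Psi w * (clamp K (X w) - q w)).
    have := integrableR_bounded (mXq k) iPsi (XqA k).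
    by congr integrableR; apply/funext => w; ring.
  have e2 : \int[P]_w (\1_(A k) w * q w * (Y w - Psi w)) = 0.
    apply: (Rintegral_condmean0 sigG subG nY _ iA2).
    apply/(measurable_wrtE sigG); apply: measurable_funM.
      exact: (measurable_wrt_indic sigG (GA k)).
    exact/(measurable_wrtE sigG).
  have e3 : \int[P]_w (\1_(A k) w * Psi w * (clamp K (X w) - q w)) = 0.
    apply: (Rintegral_condmean0 sigG subG nX _ iA3).
    apply/(measurable_wrtE sigG); apply: measurable_funM.
      exact: (measurable_wrt_indic sigG (GA k)).
    exact/(measurable_wrtE sigG).
  have i12 := integrableRD iA1 iA2.
  transitivity (0 + 0 - 0 : R); last by rewrite addr0 subr0.
  rewrite -[X in _ = X + _ - _](step2 k) -[X in _ = _ + X - _]e2 -[X in _ = _ - X]e3.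
  rewrite -RintegralD// -RintegralB//.
  by apply: eq_Rintegral => w _; ring.
apply: (@Rintegral0_limit _ _ _ P
    (fun k w => \1_(A k) w * (clamp K (X w) * (Y w - Psi w))) _
    (fun w => K * `|Y w - Psi w|)).
- move=> k; do 2 (apply: measurable_funM => //).
  exact: measurable_funB.
- by apply: measurable_funM => //; exact: measurable_funB.
- have iYPsi := integrableRB iY iPsi.
  apply: integrableRZ; apply: (integrableR_le _ iYPsi) => [|w]; last by rewrite normr_id.
  by apply: measurableT_comp => //; exact: measurable_funB.
- move=> k w; rewrite 2!normrM.
  rewrite (le_trans (ler_piMl _ (indic_le1 _ _)))// ?mulr_ge0//.
  by rewrite ler_wpM2r// clamp_bound.
- move=> w; apply: cvg_near_cst; near=> k.
  have qk : `|q w| <= k%:R by near: k; exact: nbhs_infty_ger.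
  rewrite indicE mem_set ?mul1r//=.
  by rewrite /A/= in_itv/= -ler_norml.
- exact: step3.
Unshelve. all: by end_near. Qed.

(** Independence is only available for bounded functions of [X] and [Y], hence
    the truncations. *)
Lemma cross_moment0 (X Y Psi : Omega -> R) :
  sq_integrable P X -> condexp P G Y Psi ->
  sq_integrable P (fun w => Y w - Psi w) ->
  (forall a b : nat, exists q r,
     [/\ condexp P G (fun w => clamp a%:R (X w)) q,
         condexp P G (fun w => clamp b%:R (Y w)) r &
         condexp P G (fun w => clamp a%:R (X w) * clamp b%:R (Y w))
                 (fun w => q w * r w)]) ->
  \int[P]_w (X w * (Y w - Psi w)) = 0.
Proof.
move=> sX cY sYPsi ind; have [mX _] := sX; have [mYPsi _] := sYPsi.
have iXY := sq_integrableM sX sYPsi.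
apply: (@Rintegral0_limit _ _ _ P
    (fun a w => clamp a%:R (X w) * (Y w - Psi w)) _
    (fun w => `|X w * (Y w - Psi w)|)).
- move=> a; apply: measurable_funM => //.
  by apply: measurableT_comp mX; exact: measurable_clamp.
- exact: measurable_funM.
- apply: (integrableR_le _ iXY) => [|w]; last by rewrite normr_id.
  by apply: measurableT_comp => //; exact: measurable_funM.
- by move=> a w; rewrite !normrM ler_wpM2r// clamp_le.
- by move=> w; apply: cvgMl; exact: clamp_cvg.
move=> a; have [q [_ [cq _ _]]] := ind a 0%N.
apply: (cross_truncated (q := q)) => // b.
have [q' [r [cq' cr cqr]]] := ind a b.
have qq' := condexp_unique sigG subG cq cq'.
have iq := (condexp_integrableR cq).2; have iq' := (condexp_integrableR cq').2.
have ir := (condexp_integrableR cr).2.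
exists r; split => //; apply: condexp_ae_eq cqr _ _.
  by apply/(measurable_wrtE sigG)/measurable_funM; apply/(measurable_wrtE sigG);
    [exact: condexp_measurable_wrt cq|exact: condexp_measurable_wrt cr].
by apply: filterS qq' => w ->.
Qed.

(** Conditional independence given [G], tested as in [cond_independent] on
    bounded functions, for real random variables. *)
Definition cond_indep_family (m : nat) (X : 'I_m -> Omega -> R) : Prop :=
  forall phi : 'I_m -> R -> R,
    (forall i, measurable_fun setT (phi i)) ->
    (forall i, exists K : R, forall y, `|phi i y| <= K) ->
    exists q : 'I_m -> Omega -> R,
      (forall i, condexp P G (fun w => phi i (X i w)) (q i)) /\
      condexp P G (fun w => \prod_(i < m) phi i (X i w))
                  (fun w => \prod_(i < m) q i w).

(** The other indices carry the constant function 1, whose conditional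
    expectation is almost surely 1. *)
Lemma cond_indep_pair (m : nat) (X : 'I_m -> Omega -> R) (i j : 'I_m) :
  cond_indep_family X -> i != j ->
  forall a b : nat, exists q r,
     [/\ condexp P G (fun w => clamp a%:R (X i w)) q,
         condexp P G (fun w => clamp b%:R (X j w)) r &
         condexp P G (fun w => clamp a%:R (X i w) * clamp b%:R (X j w))
                 (fun w => q w * r w)].
Proof.
move=> ind ij a b.
pose phi (l : 'I_m) : R -> R :=
  if l == i then clamp a%:R else if l == j then clamp b%:R else cst 1.
have ji : (j == i) = false by rewrite eq_sym (negbTE ij).
have [||q [cq cprod]] := ind phi.
- move=> l; rewrite /phi; case: ifP => _; first exact: measurable_clamp.
  by case: ifP => _ //; exact: measurable_clamp.
- move=> l; rewrite /phi; case: ifP => _.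
    by exists a%:R => y; exact: clamp_bound.
  case: ifP => _; first by exists b%:R => y; exact: clamp_bound.
  by exists 1 => y /=; rewrite normr1.
have qi := cq i; have qj := cq j.
rewrite /phi eqxx in qi; rewrite /phi ji eqxx in qj.
have q1 l : l != i -> l != j -> {ae P, forall w, q l w = 1}.
  move=> li lj; have := cq l; rewrite /phi (negbTE li) (negbTE lj) => ql.
  exact: (condexp_unique (Y := cst 1) sigG subG ql (condexp_cst P sigG 1)).
exists (q i), (q j); split => //.
have split2 (F : 'I_m -> R) : \prod_(l < m) F l =
    F i * F j * \prod_(l < m | (l != i) && (l != j)) F l.
  rewrite (bigD1 i)//= (bigD1 j) ?ji//= mulrA; congr (_ * _).
have <- : (fun w => \prod_(l < m) phi l (X l w)) =
    (fun w => clamp a%:R (X i w) * clamp b%:R (X j w)).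
  apply/funext => w; rewrite split2 big1 ?mulr1.
    by rewrite /phi ji !eqxx.
  by move=> l /andP[li lj]; rewrite /phi (negbTE li) (negbTE lj).
apply: condexp_ae_eq cprod _ _.
  by apply/(measurable_wrtE sigG)/measurable_funM; apply/(measurable_wrtE sigG);
    [exact: condexp_measurable_wrt qi|exact: condexp_measurable_wrt qj].
have : {ae P, forall w, forall l, l != i -> l != j -> q l w = 1}.
  apply: filter_forall => l.
  case: (boolP (l != i)) => li; last by apply: aeW => w.
  case: (boolP (l != j)) => lj; last by apply: aeW => w.
  by apply: filterS (q1 l li lj).
apply: filterS => w qw; rewrite split2 big1 ?mulr1// => l /andP[li lj].
exact: qw.
Qed.
End Cross.

(** * Second moments and the descent inequality *)

Section SecondMoments.
Context d (Omega : measurableType d) (R : realType) (P : probability Omega R).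
Implicit Types f g h : Omega -> R.

Lemma sq_integrableZ a f :
  sq_integrable P f -> sq_integrable P (fun w => a * f w).
Proof.
move=> [mf if2]; split; first exact: measurable_funM.
by under eq_fun do rewrite exprMn; exact: integrableRZ.
Qed.

Lemma sq_integrableD f g : sq_integrable P f -> sq_integrable P g ->
  sq_integrable P (fun w => f w + g w).
Proof.
move=> sf sg; have [[mf if2] [mg ig2]] := (sf, sg).
split; first exact: measurable_funD.
under eq_fun do rewrite sqrrD mulr2n.
by do !apply: integrableRD => //; exact: sq_integrableM.
Qed.

Lemma sq_integrableB f g : sq_integrable P f -> sq_integrable P g ->
  sq_integrable P (fun w => f w - g w).
Proof.
move=> sf sg; have := sq_integrableD sf (sq_integrableZ (-1) sg).
by under eq_fun do rewrite mulN1r.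
Qed.

Lemma sq_integrable_sum (I : Type) (s : seq I) (f : I -> Omega -> R) :
  (forall i, sq_integrable P (f i)) ->
  sq_integrable P (fun w => \sum_(i <- s) f i w).
Proof.
move=> fi; elim: s => [|i s IH].
  under eq_fun do rewrite big_nil; split => //.
  by under eq_fun do rewrite expr0n; exact: integrableR0.
by under eq_fun do rewrite big_cons; exact: sq_integrableD.
Qed.

Section Average.
Variable G : set (set Omega).
Hypotheses (sigG : sigma_algebra setT G) (subG : G `<=` measurable).
Variables (m n : nat) (X : 'I_m -> 'I_n -> Omega -> R) (F : 'I_n -> Omega -> R).
Hypotheses (m1 : (1 <= m)%N)
  (XF : forall i k, condexp P G (X i k) (F k))
  (sXF : forall i k, sq_integrable P (fun w => X i k w - F k w))
  (sF : forall k, sq_integrable P (F k))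
  (indX : forall k, cond_indep_family P G (fun i => X i k)).

Let xi k w := m%:R^-1 * \sum_(i < m) (X i k w - F k w).

Lemma noise_orthogonal_mean i k : \int[P]_w (F k w * (X i k w - F k w)) = 0.
Proof.
apply: (Rintegral_condmean0 sigG subG (condexp_residual subG (XF i k))).
  exact: condexp_measurable_wrt (XF i k).
exact: sq_integrableM.
Qed.

(** [cross_moment0] gives [E[X_i (X_j - F)] = 0], and [F] is orthogonal to
    [X_j - F] because it is [G]-measurable. *)
Lemma noise_uncorrelated i j k : i != j ->
  \int[P]_w ((X i k w - F k w) * (X j k w - F k w)) = 0.
Proof.
move=> ij.
have sX : sq_integrable P (X i k).
  have := sq_integrableD (sXF i k) (sF k).
  by under eq_fun do rewrite subrK.
have h := cross_moment0 sigG subG sX (XF j k) (sXF j k)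
  (cond_indep_pair sigG subG (indX k) ij).
transitivity (0 - 0 : R); last by rewrite subr0.
rewrite -[X in _ = X - _]h -[X in _ = _ - X](noise_orthogonal_mean j k).
rewrite -RintegralB//; [|exact: sq_integrableM..].
by apply: eq_Rintegral => w _; ring.
Qed.

Lemma average_noise_orthogonal k : \int[P]_w (F k w * xi k w) = 0.
Proof.
transitivity (\int[P]_w (m%:R^-1 * \sum_(i < m) (F k w * (X i k w - F k w)))).
  by apply: eq_Rintegral => w _; rewrite /xi -mulr_sumr; ring.
have i0 i : integrableR P (fun w => F k w * (X i k w - F k w)).
  exact: sq_integrableM.
rewrite RintegralZl//; last exact: integrableR_sum.
by rewrite Rintegral_sum// big1 ?mulr0// => i _; exact: noise_orthogonal_mean.
Qed.

(** Only the diagonal terms of the squared sum survive. *)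
Lemma average_noise_variance k : \int[P]_w (xi k w ^+ 2) =
  m%:R^-2 * \sum_(i < m) \int[P]_w ((X i k w - F k w) ^+ 2).
Proof.
have ii i j : integrableR P (fun w => (X i k w - F k w) * (X j k w - F k w)).
  exact: sq_integrableM.
have isum i : integrableR P
    (fun w => \sum_(j < m) (X i k w - F k w) * (X j k w - F k w)).
  exact: integrableR_sum.
transitivity (\int[P]_w (m%:R^-2 *
    \sum_(i < m) \sum_(j < m) (X i k w - F k w) * (X j k w - F k w))).
  apply: eq_Rintegral => w _; rewrite /xi exprMn exprVn; congr (_ * _).
  by rewrite expr2 mulr_suml; apply: eq_bigr => i _; rewrite mulr_sumr.
rewrite RintegralZl//; last exact: integrableR_sum.
congr (_ * _); rewrite Rintegral_sum//; apply: eq_bigr => i _.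
rewrite Rintegral_sum// (bigD1 i)//= big1 ?addr0//.
by move=> j ji; rewrite noise_uncorrelated// eq_sym.
Qed.

Lemma average_noise_le (s : R) :
  (forall i, \sum_(k < n) \int[P]_w ((X i k w - F k w) ^+ 2) <= s) ->
  \sum_(k < n) \int[P]_w (xi k w ^+ 2) <= s / m%:R.
Proof.
move=> Xs; under eq_bigr do rewrite average_noise_variance.
rewrite -mulr_sumr exchange_big/=.
have m0 : 0 < m%:R :> R by rewrite ltr0n.
rewrite expr2 invfM -mulrA [leRHS]mulrC ler_pM2l ?invr_gt0//.
rewrite mulrC ler_pdivrMr// mulr_natr.
rewrite -[leRHS]/(s *+ m) -[m in leRHS]card_ord -sumr_const.
exact: ler_sum.
Qed.

End Average.

Section Descent.
Variables (n : nat) (u g F : 'I_n -> Omega -> R).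
Hypotheses (su : forall k, sq_integrable P (u k))
  (sg : forall k, sq_integrable P (g k)) (sF : forall k, sq_integrable P (F k)).
Local Notation B a b := (\sum_(k < n) \int[P]_w (a k w * b k w)).
Let delta k w := u k w - F k w.
Let xi k w := g k w - F k w.

(** Here [B a b] stands for [E<a, b>]. As [u = (g + delta) - xi], a weighted
    Young inequality bounds [|u|^2] by [|g + delta|^2] and [|xi|^2]. The bounds
    on the ratios say that [E|g + delta|^2 <= (1 - a) E|g|^2] with
    [a = 2 eta muh - (eta ellh)^2], and the Pythagorean identity
    [E|g|^2 = E|F|^2 + E|xi|^2] concludes. *)
Lemma descent (eta muh ellh s : R) :
  let step2 := eta ^+ 2 * B g g in
  let corr := - eta * B delta g in
  0 < eta < 2 * muh / ellh ^+ 2 -> 0 < muh ->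
  muh <= corr / step2 ->
  corr / step2 <= Num.sqrt (B delta delta / step2) ->
  Num.sqrt (B delta delta / step2) <= ellh ->
  0 < step2 -> B F xi = 0 -> B xi xi <= s ->
  B u u <= (1 - (2 * eta * muh - (eta * ellh) ^+ 2)
           / (2 - 2 * eta * muh + (eta * ellh) ^+ 2)) * B F F
      + 4 * s / (eta * (2 * muh - eta * ellh ^+ 2)).
Proof.
move=> step2 corr /andP[eta0 etam] muh0 h1 h2 h3 step20 FX Xs.
have ellh0 : 0 < ellh by lra.
set a := 2 * eta * muh - (eta * ellh) ^+ 2.
have a0 : 0 < a.
  move: etam; rewrite ltr_pdivlMr ?exprn_gt0// => etam.
  rewrite /a; nra.
(* [1 - a >= (1 - eta ellh)^2], because the hypotheses force [muh <= ellh] *)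
have a1 : a <= 1.
  have : muh <= ellh by lra.
  have : 0 <= (1 - eta * ellh) ^+ 2 by exact: sqr_ge0.
  rewrite /a; nra.
have sd k : sq_integrable P (delta k) by exact: sq_integrableB.
have sx k : sq_integrable P (xi k) by exact: sq_integrableB.
have Bge0 (f : 'I_n -> Omega -> R) : 0 <= B f f.
  apply: sumr_ge0 => k _; apply: Rintegral_ge0 => w _.
  by rewrite -expr2 sqr_ge0.
have Bgg : B g g = B F F + B xi xi.
  transitivity (B F F + 2 * B F xi + B xi xi); last by rewrite FX mulr0 addr0.
  rewrite mulr_sumr -!big_split/=; apply: eq_bigr => k _.
  have iFF := sq_integrableM (sF k) (sF k).
  have iFx := integrableRZ 2 (sq_integrableM (sF k) (sx k)).
  have ixx := sq_integrableM (sx k) (sx k).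
  rewrite -RintegralZl//; last exact: sq_integrableM.
  rewrite -RintegralD// -RintegralD//; last exact: integrableRD.
  by apply: eq_Rintegral => w _; rewrite /xi; ring.
have Buu : B u u <= 2 / (2 - a) * (B g g + 2 * B delta g + B delta delta)
      + 2 / a * B xi xi.
  rewrite !mulr_sumr -!big_split/= mulr_sumr -big_split/=.
  apply: ler_sum => k _.
  have igg := sq_integrableM (sg k) (sg k).
  have idg := integrableRZ 2 (sq_integrableM (sd k) (sg k)).
  have idd := sq_integrableM (sd k) (sd k).
  have ixx := sq_integrableM (sx k) (sx k).
  rewrite -RintegralZl//; last exact: sq_integrableM.
  rewrite -RintegralD// -RintegralD//; last exact: integrableRD.
  have i1 := integrableRD (integrableRD igg idg) idd.
  rewrite -RintegralZl// -RintegralZl// -RintegralD//; [|exact: integrableRZ..].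
  apply: le_Rintegral => //.
  - exact: sq_integrableM.
  - by apply: integrableRD; exact: integrableRZ.
  move=> w _.
  set p := g k w + delta k w; set q := xi k w.
  have -> : u k w = p - q by rewrite /p /q /delta /xi; ring.
  have -> : g k w * g k w + 2 * (delta k w * g k w) + delta k w * delta k w =
     p ^+ 2 by rewrite /p; ring.
  (* The weights 2/(2-a) and 2/a make [2/(2-a) (1-a)] the contraction factor of
     the conclusion; the defect in Young's inequality is then a square. *)
  rewrite -subr_ge0.
  have -> : 2 / (2 - a) * p ^+ 2 + 2 / a * (q * q) - (p - q) * (p - q) =
      (a * p + (2 - a) * q) ^+ 2 / (a * (2 - a)).
    by field; rewrite !gt_eqF//; lra.
  by rewrite divr_ge0 ?sqr_ge0// mulr_ge0//; lra.
have hc : muh * eta * B g g <= - B delta g.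
  move: h1; rewrite ler_pdivlMr// /step2 /corr => h1.
  rewrite -(ler_pM2l eta0); nra.
have hd : B delta delta <= ellh ^+ 2 * eta ^+ 2 * B g g.
  have r0 : 0 <= B delta delta / step2 by rewrite divr_ge0// ltW.
  have : B delta delta / step2 <= ellh ^+ 2.
    by rewrite -(sqr_sqrtr r0) lerXn2r// nnegrE ?sqrtr_ge0// ltW.
  by rewrite ler_pdivrMr// /step2 mulrA.
have hgd : B g g + 2 * B delta g + B delta delta <= (1 - a) * (B F F + B xi xi).
  rewrite -Bgg /a exprMn; nra.
have a2 : 0 < 2 - a by lra.
have -> : 2 - 2 * eta * muh + (eta * ellh) ^+ 2 = 2 - a by rewrite /a; ring.
have -> : eta * (2 * muh - eta * ellh ^+ 2) = a by rewrite /a; ring.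
apply: (le_trans Buu).
have h4 : 2 / (2 - a) * (B g g + 2 * B delta g + B delta delta) <=
   2 / (2 - a) * ((1 - a) * (B F F + B xi xi)).
  by rewrite ler_pM2l// divr_gt0.
have h5 : (2 * (1 - a) / (2 - a) + 2 / a) * B xi xi <= 4 / a * s.
  have : (2 * (1 - a) / (2 - a) + 2 / a) <= 4 / a.
    rewrite -subr_ge0.
    have -> : 4 / a - (2 * (1 - a) / (2 - a) + 2 / a) =
      (2 * (2 - a) - 2 * a * (1 - a)) / (a * (2 - a)).
      by field; rewrite !gt_eqF.
    rewrite divr_ge0//; [nra|nra].
  move=> /(ler_wpM2r (Bge0 xi))/le_trans; apply.
  by rewrite ler_pM2l// divr_gt0.
have -> : 1 - a / (2 - a) = 2 * (1 - a) / (2 - a) by field; rewrite gt_eqF.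
have -> : 4 * s / a = 4 / a * s by rewrite mulrAC.
apply: (le_trans (lerD h4 (lexx _))).
apply: le_trans (lerD (lexx _) h5).
by rewrite le_eqVlt; apply/orP; left; apply/eqP; field; rewrite !gt_eqF.
Qed.
End Descent.
End SecondMoments.

(** * Derivatives of matrix-valued maps *)

Section MatrixDerivatives.
Context (R : realType).

Lemma differentiable_mx (V : normedModType R) m n (f : V -> 'M[R]_(m, n)) x :
  (forall i j, differentiable (fun y => f y i j) x) -> differentiable f x.
Proof.
move=> df.
have -> : f = \sum_(i < m) \sum_(j < n) (fun y => f y i j *: delta_mx i j).
  apply/funext => y; rewrite fct_sumE [LHS]matrix_sum_delta.
  by apply: eq_bigr => i _; rewrite fct_sumE.
apply: differentiable_sum => i; apply: differentiable_sum => j.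
exact: differentiableZl.
Qed.

Lemma derive_coord_sum (W : normedModType R) n (f : 'rV[R]_n -> W) x v :
  differentiable f x -> 'd f x v = \sum_(l < n) v 0 l *: 'D_('e_l) f x.
Proof.
move=> df; rewrite {1}(row_sum_delta v) linear_sum; apply: eq_bigr => l _.
by rewrite linearZ/= deriveE.
Qed.

Lemma derivable_comp_derive (W : normedModType R) n (p : R -> 'rV[R]_n)
    (f : 'rV[R]_n -> W) s :
  derivable p s 1 -> differentiable f (p s) ->
  is_derive s (1 : R) (f \o p) (\sum_(l < n) (derive1 p s) 0 l *: 'D_('e_l) f (p s)).
Proof.
move=> /derivable1_diffP dp df.
have dfp : differentiable (f \o p) s by exact: differentiable_comp.
apply: DeriveDef; first exact: diff_derivable.
by rewrite deriveE// diff_comp//= -derive_coord_sum// derive1E'.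
Qed.

Lemma is_derive_mxE (V : normedModType R) m n (f : V -> 'M[R]_(m, n)) x v df i j :
  is_derive x v f df -> is_derive x v (fun y => f y i j) (df i j).
Proof.
move=> [fx <-]; apply: DeriveDef; first exact: (derivable_mxP _ _ _).1.
by rewrite derive_mx// mxE.
Qed.

End MatrixDerivatives.

(** * Riemannian manifolds and the Levi-Civita connection *)

Section Riemannian.
Variables (R : realType) (n : nat) (M : topologicalType).
Implicit Type S : riemannianData R n M.

(** Regularity of order one is singled out because it passes to products with a
    single application of the chain rule; [prod_riemannian_C1] is what makes
    the lemmas below available on the joint action manifold. *)
Record C1_riemannian S : Prop := C1Riemannian {
  C1_second_countable : @second_countable M;
  C1_chart : forall c, atlas S c -> is_chart c;
  C1_metric : forall c, atlas S c -> class_C 1 (cod c) (metric c);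
  C1_metric_sym : forall c p, atlas S c -> cod c p ->
    (metric c p)^T = metric c p;
  C1_metric_pos : forall c p (v : 'rV[R]_n), atlas S c -> cod c p -> v != 0 ->
    0 < (v *m metric c p *m v^T) 0 0;
  C1_chart_at : forall x, atlas S (chart_at S x) /\ dom (chart_at S x) x;
  C1_transition : forall c d, atlas S c -> atlas S d ->
    class_C 1 (coord c @` (dom c `&` dom d)) (transition c d);
  C1_metric_law : forall c d x, atlas S c -> atlas S d -> dom c x -> dom d x ->
    metric c (coord c x) = 'J (transition c d) (coord c x)
      *m metric d (coord d x) *m ('J (transition c d) (coord c x))^T
}.

Lemma riemannian_manifold_C1 S : riemannian_manifold S -> C1_riemannian S.
Proof.
move=> [[_ sc] ch cat tr law]; split => //.
- by move=> c /ch[].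
- by move=> c /ch[_ [/(_ 1%N)]].
- by move=> c p /ch[_ [_ + _]]; apply.
- by move=> c p v /ch[_ [_ _ +]]; apply.
- by move=> c d cS dS; exact: (tr c d cS dS 1%N).
Qed.

Lemma posdef_unitmx (k : nat) (g : 'M[R]_k) :
  (forall v : 'rV[R]_k, v != 0 -> 0 < (v *m g *m v^T) 0 0) -> g \in unitmx.
Proof.
move=> pos; rewrite unitmxE unitfE; apply/det0P => -[v v0 vg].
by have := pos _ v0; rewrite vg mul0mx mxE ltxx.
Qed.

(** Coordinates are open maps, since [point c] is continuous on an open set. *)
Lemma chart_open_image (c : chart R n M) (U : set M) : is_chart c -> open U ->
  open (coord c @` (dom c `&` U)).
Proof.
move=> [oc occ pK cc cp] oU.
have -> : coord c @` (dom c `&` U) = cod c `&` point c @^-1` U.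
  apply/seteqP; split => [_ [x [cx Ux] <-]|_ [[x cx <-] Ux]].
    by split; [exists x|rewrite /= pK].
  by exists x => //; split => //; move: Ux; rewrite /= pK.
rewrite openE => p [cp' Up]; rewrite /interior; apply: filterI.
  exact: open_nbhs_nbhs.
rewrite continuous_open_subspace// in cp.
by apply: (cp p); [rewrite inE|exact: open_nbhs_nbhs].
Qed.

Variable S : riemannianData R n M.
Hypothesis HS : C1_riemannian S.

Lemma metric_unit c x : atlas S c -> dom c x -> metric c (coord c x) \in unitmx.
Proof.
move=> cS cx; apply: posdef_unitmx => v v0.
by apply: (C1_metric_pos HS) => //; exists x.
Qed.

Lemma inner_chart c x v w : atlas S c -> dom c x ->
  inner S x v w =
  (to_chart S x c v *m metric c (coord c x) *m (to_chart S x c w)^T) 0 0.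
Proof.
move=> cS cx; have [aS ax] := C1_chart_at HS x.
rewrite /inner (C1_metric_law HS aS cS ax cx) /to_chart.
by rewrite trmx_mul !mulmxA.
Qed.

(** Compatibility of the Levi-Civita connection with the metric, for the
    parallel field [v' = - Gamma(p', v)]: the derivative of [v g v^T] vanishes.
    Lowering the upper index of the Christoffel symbols leaves three first
    derivatives of [g]. Two of them cancel each other in the sum with the
    symmetric factor [v_b v_j], and the third one is compensated by the
    derivative of [g] along [p']. *)
Lemma christoffel_metric c x (p' v : 'rV[R]_n) : atlas S c -> dom c x ->
  let g := metric c (coord c x) in
  2 * ((- christoffel_form c (coord c x) p' v) *m g *m v^T) 0 0 +
  (v *m (\sum_(l < n) p' 0 l *: 'D_('e_l) (metric c) (coord c x)) *m v^T) 0 0 = 0.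
Proof.
move=> cS cx g; set dg := fun a b e => ('D_('e_a) (metric c) (coord c x)) b e.
have gu : g \in unitmx := metric_unit cS cx.
have gsym : g^T = g by apply: (C1_metric_sym HS) => //; exists x.
have lower a b j : \sum_k christoffel c (coord c x) k a b * g k j =
    2^-1 * (dg a b j + dg b a j - dg j a b).
  under eq_bigr => k _ do rewrite /christoffel -mulrA mulr_suml.
  rewrite -mulr_sumr exchange_big/=; congr (_ * _).
  rewrite (bigD1 j)//= [X in _ + X]big1 ?addr0 => [|l lj].
    under eq_bigr => k _ do rewrite mulrAC.
    rewrite -mulr_suml (_ : \sum_k _ = 1) ?mul1r//.
    have := congr1 (fun A : 'M[R]_n => A j j) (mulmxV gu).
    rewrite !mxE eqxx mulr1n => <-; apply: eq_bigr => k _.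
    rewrite mulrC; congr (_ * _); first by rewrite -[in LHS]gsym mxE.
  under eq_bigr => k _ do rewrite mulrAC.
  rewrite -mulr_suml (_ : \sum_k _ = 0) ?mul0r//.
  have := congr1 (fun A : 'M[R]_n => A j l) (mulmxV gu).
  rewrite !mxE eq_sym (negbTE lj) mulr0n => gl0.
  apply: etrans gl0; apply: eq_bigr => k _.
  by rewrite mulrC; congr (_ * _); rewrite -[in LHS]gsym mxE.
pose T a b j := p' 0 a * v 0 b * v 0 j.
have -> : ((- christoffel_form c (coord c x) p' v) *m g *m v^T) 0 0 =
    - 2^-1 * \sum_j \sum_a \sum_b T a b j * (dg a b j + dg b a j - dg j a b).
  rewrite mxE mulr_sumr; apply: eq_bigr => j _; rewrite !mxE mulr_suml.
  transitivity (\sum_k \sum_a \sum_b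
     - (p' 0 a * v 0 b * v 0 j * (christoffel c (coord c x) k a b * g k j))).
    apply: eq_bigr => k _; rewrite !mxE -sumrN !mulr_suml.
    apply: eq_bigr => a _; rewrite -sumrN !mulr_suml; apply: eq_bigr => b _.
    by ring.
  rewrite exchange_big mulr_sumr/=; apply: eq_bigr => a _.
  rewrite exchange_big mulr_sumr/=; apply: eq_bigr => b _.
  rewrite sumrN -mulr_sumr lower /T.
  by ring.
have -> : (v *m (\sum_(l < n) p' 0 l *: 'D_('e_l) (metric c) (coord c x))
    *m v^T) 0 0 = \sum_j \sum_a \sum_b T a b j * dg a b j.
  rewrite mxE; apply: eq_bigr => j _; rewrite !mxE mulr_suml.
  rewrite exchange_big/=; apply: eq_bigr => b _; rewrite summxE mulr_sumr mulr_suml.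
  by apply: eq_bigr => a _; rewrite !mxE /T /dg; ring.
have swap : \sum_j \sum_a \sum_b T a b j * dg b a j =
    \sum_j \sum_a \sum_b T a b j * dg j a b.
  rewrite exchange_big [RHS]exchange_big/=; apply: eq_bigr => a _.
  rewrite exchange_big/=; apply: eq_bigr => b _; apply: eq_bigr => j _.
  by rewrite /T; ring.
have -> : \sum_j \sum_a \sum_b T a b j * (dg a b j + dg b a j - dg j a b) =
  \sum_j \sum_a \sum_b T a b j * dg a b j + \sum_j \sum_a \sum_b T a b j * dg b a j
  - \sum_j \sum_a \sum_b T a b j * dg j a b.
  do 3 (rewrite -sumrN -!big_split/=; apply: eq_bigr => ? _).
  by ring.
by rewrite swap; field.
Qed.

End Riemannian.

(** * Parallel transport is an isometry *)

(** The product rule for [v G v^T], where [w] and [H] are the derivatives of [v]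
    and [G]; the left-hand side is what termwise differentiation produces. *)
Lemma quadratic_form_derive (R : comRingType) n (v w : 'rV[R]_n) (G H : 'M[R]_n) :
  G^T = G ->
  \sum_(j < n) ((\sum_(i < n) v 0 i * G i j) * w 0 j +
     v 0 j * \sum_(i < n) (v 0 i * H i j + G i j * w 0 i)) =
  2 * (w *m G *m v^T) 0 0 + (v *m H *m v^T) 0 0.
Proof.
move=> Gs; rewrite mulr_natl mulr2n.
have {1}-> : (w *m G *m v^T) 0 0 = (v *m G *m w^T) 0 0.
  transitivity ((w *m G *m v^T)^T 0 0); first by rewrite [RHS]mxE.
  by rewrite !trmx_mul trmxK Gs mulmxA.
rewrite !mxE -!big_split/=; apply: eq_bigr => j _; rewrite !mxE -addrA.
congr (_ + _); rewrite big_split/= mulrDr [LHS]addrC; congr (_ + _); rewrite mulrC//.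
by congr (_ * _); apply: eq_bigr => i _; rewrite mulrC.
Qed.

Lemma quadratic_formE (R : pzRingType) n (v : 'rV[R]_n) (G : 'M[R]_n) :
  (v *m G *m v^T) 0 0 = \sum_(j < n) (\sum_(i < n) v 0 i * G i j) * v 0 j.
Proof. by rewrite mxE; apply: eq_bigr => j _; rewrite !mxE. Qed.

Section Isometry.
Variables (R : realType) (n : nat) (M : topologicalType).
Variable S : riemannianData R n M.
Hypothesis HS : C1_riemannian S.

(** Near [s] everything is read in one fixed chart around [gamma s]. *)
Lemma normsq_parallel_derive (gamma : R -> M) (V : R -> 'rV[R]_n) (s : R) :
  curve_at S gamma s -> parallel_at S gamma V s ->
  is_derive s (1 : R) (fun r => normsq S (gamma r) (V r)) 0.
Proof.
move=> [gcont gder] par; set c := chart_at S (gamma s).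
have [cS cx] := C1_chart_at HS (gamma s).
have [od _ _ _ _] := C1_chart HS cS.
pose v r := to_chart S (gamma r) c (V r).
pose G r := metric c (coord c (gamma r)).
pose phi : R -> R := \sum_(j < n)
  ((\sum_(i < n) ((fun r => v r 0 i) * (fun r => G r i j))) *
   (fun r => v r 0 j)).
have phiE r : phi r = (v r *m G r *m (v r)^T) 0 0.
  rewrite quadratic_formE /phi fct_sumE; apply: eq_bigr => j _.
  by rewrite mulrfctE fct_sumE.
have near_phi : \forall r \near s, phi r = normsq S (gamma r) (V r).
  have : \forall r \near s, dom c (gamma r).
    by apply: gcont; exact: open_nbhs_nbhs.
  by apply: filterS => r dr; rewrite phiE /normsq (inner_chart HS _ _ cS dr).
have pd := gder c cS cx.
have [mdiff _] := C1_metric HS cS.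
have dG := derivable_comp_derive pd (mdiff _ (imageP _ cx)).
have dv := par c cS cx.
apply: (near_eq_is_derive near_phi).
set dv' := - christoffel_form _ _ _ _ in dv.
set dG' := \sum_(l < n) _ in dG.
have dvi i := is_derive_mxE 0 i dv.
have dGij i j := is_derive_mxE i j dG.
pose f1 i j : R -> R := (fun r => v r 0 i) * (fun r => G r i j).
have d1 i j : is_derive s (1 : R) (f1 i j)
    (v s 0 i *: dG' i j + G s i j *: dv' 0 i).
  exact: is_deriveM.
have d2 j := @is_derive_sum _ _ _ n (f1^~ j) s 1 _ (d1^~ j).
pose f3 j : R -> R := (\sum_(i < n) f1 i j) * (fun r => v r 0 j).
have d3 j : is_derive s (1 : R) (f3 j)
    ((\sum_(i < n) f1 i j) s *: dv' 0 j +
     v s 0 j *: \sum_(i < n) (v s 0 i *: dG' i j + G s i j *: dv' 0 i)).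
  exact: is_deriveM.
apply: (is_derive_eq (@is_derive_sum _ _ _ n f3 s 1 _ d3)).
have gsym : (G s)^T = G s.
  by apply: (C1_metric_sym HS cS); exists (gamma s).
apply: etrans
  (christoffel_metric HS (derive1 (coord c \o gamma) s) (v s) cS cx).
apply: etrans (quadratic_form_derive _ _ _ gsym).
by apply: eq_bigr => j _; rewrite fct_sumE.
Qed.

Lemma transport_isometry (gamma : R -> M) (w u : 'rV[R]_n) :
  geodesic S gamma -> transport S gamma w u ->
  normsq S (gamma 1) w = normsq S (gamma 0) u.
Proof.
move=> [e e0 geo] [V [par <- <-]].
pose h r := normsq S (gamma r) (V r).
have dh (s : R) : 0 <= s <= 1 -> is_derive s (1 : R) h 0.
  move=> s01; apply: normsq_parallel_derive (par _ s01).
  by apply: (geo s _).1; case/andP: s01 => ? ?; apply/andP; split; lra.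
have hc (x : R) : x \in `]0, 1[%R -> is_derive x (1 : R) h 0.
  by rewrite in_itv/= => /andP[x0 x1]; apply: dh; rewrite !ltW.
have hcont : {within `[0, 1], continuous h}.
  apply: derivable_within_continuous => x /[1!in_itv]/= x01.
  by case: (dh x x01).
have [c _ /eqP] := MVT_segment ler01 hc hcont.
by rewrite mul0r subr_eq0 => /eqP.
Qed.
End Isometry.

(** * Countable bases *)

Section SecondCountable.

Lemma second_countable_seq (T : topologicalType) : @second_countable T ->
  exists e : nat -> set T, (forall k, open (e k)) /\
    (forall x A, nbhs x A -> exists k, e k x /\ e k `<=` A).
Proof.
move=> [B /pfcard_geP[B0|[f]] [Bopen Bnbhs]].
  exists (fun=> set0); split => [_|x A /Bnbhs[U [BU _]]]; first exact: open0.
  by rewrite B0 in BU.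
exists f; split => [k|x A /Bnbhs[U [BU Ux] UA]].
  by apply: Bopen; exact: funS.
have [k _ fkU] := @surj _ _ _ _ f _ BU.
by exists k; rewrite fkU.
Qed.

Lemma second_countable_index (T : topologicalType) (I : countType)
    (e : I -> set T) : (forall k, open (e k)) ->
  (forall x A, nbhs x A -> exists k, e k x /\ e k `<=` A) -> @second_countable T.
Proof.
move=> eo en; exists (range e).
  exact: (card_le_trans (card_image_le _ _) (countableP _)).
split; first by move=> _ [k _ <-].
move=> x A /en[k [ekx ekA]]; exists (e k) => //.
Qed.

(** The basis consists of the boxes of basic open sets, indexed by the countable
    type of finite functions from ['I_N] to [nat]. *)
Lemma second_countable_prod (N : nat) (M : 'I_N -> topologicalType) :
  (forall i, @second_countable (M i)) -> @second_countable (prod_topology M).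
Proof.
move=> sc.
pose e i := sval (cid (second_countable_seq (sc i))).
have eP i := svalP (cid (second_countable_seq (sc i))).
pose box (k : {ffun 'I_N -> nat}) : set (prod_topology M) :=
  [set x | forall i, e i (k i) (x i)].
have projc i : continuous (fun x : prod_topology M => x i).
  exact: (@proj_continuous _ M i).
apply: (@second_countable_index _ {ffun 'I_N -> nat} box).
  move=> k; rewrite openE => x bx; rewrite /interior.
  apply: (@filter_forall _ _
    (fun i (y : prod_topology M) => e i (k i) (y i)) (nbhs x) _) => i.
  apply: (projc i x (e i (k i))).
  by apply: open_nbhs_nbhs; split; [exact: (eP i).1|exact: bx].
move=> x.
suff : filter_from [set k | box k x] box --> x.
  by move=> h A /h[k bk bA]; exists k.
have ind (A : forall i, set (M i)) : (forall i, nbhs (x i) (A i)) ->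
    exists k, box k x /\ forall i, e i (k i) `<=` A i.
  move=> Ax; have /choice[k kP] i : exists k, e i k (x i) /\ e i k `<=` A i.
      exact: (eP i).2.
  by exists [ffun i => k i]; split => i; rewrite ffunE; have [] := kP i.
have FF : Filter (filter_from [set k | box k x] box).
  apply: filter_from_filter.
    have [k [kx _]] := ind (fun=> setT) (fun=> filterT).
    by exists k.
  move=> k l kx lx; have [|m [mx mkl]] := ind (fun i => e i (k i) `&` e i (l i)).
    move=> i; apply: open_nbhs_nbhs; split.
      by apply: openI; exact: (eP i).1.
    by split; [exact: kx|exact: lx].
  by exists m => // y my; split => i; have [] := mkl i _ (my i).
apply/cvg_sup => i A [B [[C oC <-] Cx] BA].
(* the sets [C] in the coordinate [i] and [setT] in all the others *)
have [|k [kx kC]] := ind (fun j =>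
    [set y : M j | forall h : j = i, C (ecast z (M z) h y)]).
  move=> j; case: (eqVneq j i) => [ji|ji].
    subst j; apply: filterS (open_nbhs_nbhs (conj oC Cx)) => y Cy h.
    by rewrite eq_axiomK.
  by apply: nearW => y h; rewrite h eqxx in ji.
exists k => // y ky; apply: BA => /=.
exact: (kC i (y i) (ky i) erefl).
Qed.

End SecondCountable.

(** * Block matrices *)

Section BlockMatrices.
Context (R : comNzRingType) (N : nat) (p_ : 'I_N -> nat).

(** Multiplication by this matrix extracts the [i]-th block, and multiplication
    by its transpose puts it back. Block constructions become sums of products
    of matrices, which the chain rule differentiates term by term. *)
Definition block_incl (i : 'I_N) : 'M[R]_(\sum_j p_ j, p_ i) := submxrow 1%:M i.

Lemma mulmx_block_incl m (A : 'M[R]_(m, \sum_j p_ j)) i :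
  A *m block_incl i = submxrow A i.
Proof. by rewrite mul_submxrow mulmx1. Qed.

Lemma block_incl_id i : (block_incl i)^T *m block_incl i = 1%:M.
Proof.
rewrite mulmx_block_incl tr_submxrow trmx1 -submxblockEv -mxdiagZ.
exact: submxblock_diag.
Qed.

Lemma block_incl_ortho i j : i != j -> (block_incl i)^T *m block_incl j = 0.
Proof.
move=> ij; rewrite mulmx_block_incl tr_submxrow trmx1 -submxblockEv -mxdiagZ.
by rewrite /mxdiag mxblockK (negbTE ij).
Qed.

Lemma mxrow_block_sum m (v : forall i, 'M[R]_(m, p_ i)) :
  \mxrow_i v i = \sum_i v i *m (block_incl i)^T.
Proof.
apply/mxrowP => j; rewrite mxrowK -mulmx_block_incl mulmx_suml (bigD1 j)//=.
rewrite -mulmxA block_incl_id mulmx1 big1 ?addr0// => i ij.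
by rewrite -mulmxA block_incl_ortho// mulmx0.
Qed.

Lemma eq_mulmx_rV m n (A B : 'M[R]_(m, n)) :
  (forall v : 'rV[R]_m, v *m A = v *m B) -> A = B.
Proof. by move=> AB; apply/row_matrixP => i; rewrite !rowE AB. Qed.

Definition block_diag (B : forall i, 'M[R]_(p_ i)) : 'M[R]_(\sum_j p_ j) :=
  \sum_i block_incl i *m B i *m (block_incl i)^T.

Lemma mxdiag_block_sum (B : forall i, 'M[R]_(p_ i)) :
  \mxdiag_i B i = block_diag B.
Proof.
apply: eq_mulmx_rV => v; rewrite -{1}(submxrowK v) mul_mxrow_mxdiag.
rewrite mxrow_block_sum mulmx_sumr; apply: eq_bigr => i _.
by rewrite !mulmxA mulmx_block_incl.
Qed.

Lemma block_diagM (A B : forall i, 'M[R]_(p_ i)) :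
  block_diag A *m block_diag B = block_diag (fun i => A i *m B i).
Proof.
rewrite mulmx_suml; apply: eq_bigr => i _; rewrite mulmx_sumr [LHS](bigD1 i)//=.
rewrite [X in _ + X]big1 ?addr0 => [|j ji].
  by rewrite !mulmxA; congr (_ *m _ *m _); rewrite -!mulmxA block_incl_id mulmx1.
rewrite !mulmxA -[X in X *m _ *m _ = _]mulmxA block_incl_ortho 1?eq_sym//.
by rewrite mulmx0 !mul0mx.
Qed.

Lemma tr_block_diag (A : forall i, 'M[R]_(p_ i)) :
  (block_diag A)^T = block_diag (fun i => (A i)^T).
Proof.
rewrite raddf_sum; apply: eq_bigr => i _.
by rewrite /= !trmx_mul trmxK mulmxA.
Qed.

Lemma block_diag_form (A : forall i, 'M[R]_(p_ i)) (v : 'rV[R]_(\sum_j p_ j)) :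
  (v *m block_diag A *m v^T) 0 0 =
  \sum_i (submxrow v i *m A i *m (submxrow v i)^T) 0 0.
Proof.
rewrite mulmx_sumr mulmx_suml summxE; apply: eq_bigr => i _.
by rewrite -!mulmx_block_incl trmx_mul !mulmxA.
Qed.

End BlockMatrices.

(** * Maps of class C^1 *)

Section C1Functions.
Context (R : realType).

Lemma near_eq_continuous (T U : topologicalType) (f g : T -> U) x :
  (\forall y \near x, f y = g y) -> {for x, continuous f} -> {for x, continuous g}.
Proof.
move=> fg cf; rewrite /prop_for /continuous_at -(nbhs_singleton fg).
exact: (cvg_trans (near_eq_cvg fg)).
Qed.

Lemma differentiable_mulmx a b k l (P : 'M[R]_(a, b)) (Q : 'M[R]_(k, l)) X :
  differentiable (fun A : 'M[R]_(b, k) => P *m A *m Q) X.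
Proof.
apply: differentiable_mx => i j.
have -> : (fun A => (P *m A *m Q) i j) =
    \sum_(s < k) \sum_(r < b) (fun A : 'M[R]_(b, k) => A r s *: (P i r * Q s j)).
  apply/funext => A; rewrite fct_sumE mxE; apply: eq_bigr => s _.
  rewrite mxE fct_sumE mulr_suml; apply: eq_bigr => r _.
  by rewrite /GRing.scale/=; ring.
apply: differentiable_sum => s; apply: differentiable_sum => r.
by apply: differentiableZl; exact: differentiable_coord.
Qed.

Lemma continuous_mulmx a b k l (P : 'M[R]_(a, b)) (Q : 'M[R]_(k, l)) :
  continuous (fun A : 'M[R]_(b, k) => P *m A *m Q).
Proof. by move=> X; exact/differentiable_continuous/differentiable_mulmx. Qed.

Lemma diff_mulmx a b k l (P : 'M[R]_(a, b)) (Q : 'M[R]_(k, l)) X :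
  'd (fun A : 'M[R]_(b, k) => P *m A *m Q) X = (fun A => P *m A *m Q) :> (_ -> _).
Proof.
have lin : linear (fun A : 'M[R]_(b, k) => P *m A *m Q).
  by move=> c A B; rewrite mulmxDr mulmxDl -scalemxAr -scalemxAl.
pose linM := GRing.isLinear.Build _ _ _ _ _ lin.
pose L : {linear 'M[R]_(b, k) -> 'M[R]_(a, l)} := HB.pack (fun A => P *m A *m Q) linM.
exact: (diff_lin (f := L) X (@continuous_mulmx _ _ _ _ P Q)).
Qed.

Lemma continuous_mulmxr k l (Q : 'M[R]_(k, l)) :
  continuous (fun v : 'rV[R]_k => v *m Q).
Proof.
have := @continuous_mulmx _ _ _ _ (1%:M : 'M[R]_1) Q.
by under eq_fun do rewrite mul1mx.
Qed.

(** In blocks, the product metric and the transition maps of product charts are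
    sums of maps of this shape. *)
Section Sandwich.
Variables (k l a b a' b' : nat) (f : 'rV[R]_k -> 'M[R]_(a, b))
  (P : 'M[R]_(a', a)) (Q : 'M[R]_(b, b')) (E : 'M[R]_(l, k)).
Let F p := P *m f (p *m E) *m Q.

Lemma differentiable_sandwich p : differentiable f (p *m E) ->
  differentiable F p /\ forall v, 'D_v F p = P *m 'D_(v *m E) f (p *m E) *m Q.
Proof.
move=> df.
have dE : differentiable (fun q : 'rV[R]_l => q *m E) p.
  have := @differentiable_mulmx _ _ _ _ (1%:M : 'M[R]_1) E p.
  by under eq_fun do rewrite mul1mx.
have dEE : 'd (fun q : 'rV[R]_l => q *m E) p = (fun q => q *m E) :> (_ -> _).
  have := @diff_mulmx _ _ _ _ (1%:M : 'M[R]_1) E p.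
  by under eq_fun do rewrite mul1mx.
have dfE : differentiable (f \o (fun q : 'rV[R]_l => q *m E)) p.
  exact: differentiable_comp.
have dF : differentiable F p.
  exact: (differentiable_comp dfE (@differentiable_mulmx _ _ _ _ P Q _)).
split => // v; rewrite deriveE//.
have -> : F = (fun A => P *m A *m Q) \o (f \o (fun q => q *m E)) by [].
rewrite diff_comp//=; last exact: differentiable_mulmx.
by rewrite diff_mulmx diff_comp//= dEE -deriveE.
Qed.

Lemma class_C1_sandwich (O : set 'rV[R]_k) : open O -> class_C 1 O f ->
  class_C 1 [set p | O (p *m E)] F.
Proof.
move=> oO [df cDf]; split => [p Op|v p Op].
  by have [] := differentiable_sandwich (df _ Op).
have near_eq : \forall q \near p, P *m 'D_(v *m E) f (q *m E) *m Q = 'D_v F q.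
  have : \forall q \near p, O (q *m E).
    by apply: continuous_mulmxr; exact: open_nbhs_nbhs.
  by apply: filterS => q Oq; have [_ ->] := differentiable_sandwich (df _ Oq).
apply: (near_eq_continuous near_eq).
have c1 : {for p, continuous ('D_(v *m E) f \o (fun q => q *m E))}.
  by apply: continuous_comp; [exact: continuous_mulmxr|exact: cDf].
have c2 : {for p, continuous ((fun A => P *m A *m Q) \o
    ('D_(v *m E) f \o (fun q => q *m E)))}.
  by apply: continuous_comp; [exact: c1|exact: continuous_mulmx].
exact: c2.
Qed.
End Sandwich.

Lemma continuous_sum (T : topologicalType) (W : normedModType R) n
    (f : 'I_n -> T -> W) x : (forall i, {for x, continuous (f i)}) ->
  {for x, continuous (\sum_(i < n) f i)}.
Proof.
move=> cf; elim/big_ind: _ => [|g h cg ch|i _]; last exact: cf.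
  exact: cst_continuous.
exact: continuousD.
Qed.

Lemma class_C1_sum (V W : normedModType R) n (f : 'I_n -> V -> W) (O : set V) :
  open O -> (forall i, class_C 1 O (f i)) -> class_C 1 O (\sum_(i < n) f i).
Proof.
move=> oO cf; split => [p Op|v p Op].
  by apply: differentiable_sum => i; exact: (cf i).1.
have near_eq : \forall q \near p,
    (\sum_(i < n) 'D_v (f i)) q = 'D_v (\sum_(i < n) f i) q.
  have : \forall q \near p, O q by exact: open_nbhs_nbhs.
  apply: filterS => q Oq; rewrite derive_sum ?fct_sumE// => i.
  exact/diff_derivable/(cf i).1.
apply: (near_eq_continuous near_eq).
by apply: continuous_sum => i; exact: (cf i).2.
Qed.

Lemma class_C1_subset (V W : normedModType R) (f : V -> W) (O O' : set V) :
  O' `<=` O -> class_C 1 O f -> class_C 1 O' f.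
Proof.
by move=> OO' [df cf]; split => [p /OO'/df|v p /OO'/cf] //; exact.
Qed.

End C1Functions.

(** * Products of Riemannian manifolds *)

Section ProductManifold.
Variables (R : realType) (N : nat) (dim : 'I_N -> nat).
Variable M : 'I_N -> topologicalType.
Variable S : forall i, riemannianData R (dim i) (M i).
Hypothesis HS : forall i, C1_riemannian (S i).
Arguments HS : clear implicits.

Local Notation PM := (prod_topology M).
Local Notation E i := (block_incl R dim i).

Let cproj i : continuous (fun x : PM => x i).
Proof. exact: (@proj_continuous _ M i). Qed.
Arguments cproj : clear implicits.

Lemma continuous_into_prod (T : topologicalType) (f : T -> PM) (x : T) :
  (forall i, {for x, continuous (fun y => f y i)}) -> {for x, continuous f}.
Proof.
move=> cf; have FF : Filter (f @ x) by apply: fmap_filter; exact: nbhs_filter.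
apply/cvg_sup => i A [B [[C oC <-] Cx] BA]; apply: (filterS BA).
by apply: (cf i C); exact: open_nbhs_nbhs.
Qed.

Lemma open_box (A : forall i, set (M i)) : (forall i, open (A i)) ->
  open [set x : PM | forall i, A i (x i)].
Proof.
move=> oA; rewrite openE => x Ax; rewrite /interior.
apply: (@filter_forall _ _ (fun i (y : PM) => A i (y i)) (nbhs x) _) => i.
apply: (cproj i x (A i)); apply: open_nbhs_nbhs; split; [exact: oA|exact: Ax].
Qed.

Lemma open_block_box (A : forall i, set 'rV[R]_(dim i)) :
  (forall i, open (A i)) ->
  open [set p : 'rV[R]_(\sum_i dim i) | forall i, A i (p *m E i)].
Proof.
move=> oA; rewrite openE => p Ap; rewrite /interior.
apply: (@filter_forall _ _ (fun i q => A i (q *m E i)) (nbhs p) _) => i.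
by apply: (continuous_mulmxr (Q := E i)); apply: open_nbhs_nbhs; split;
  [exact: oA|exact: Ap].
Qed.

Section ProductChart.
Variable c : forall i, chart R (dim i) (M i).
Hypothesis cS : forall i, atlas (S i) (c i).
Arguments cS : clear implicits.

Let ch i : is_chart (c i). Proof. refine (C1_chart (HS i) (cS i)). Qed.
Arguments ch : clear implicits.

Lemma coord_block (x : PM) i : coord (prod_chart c) x *m E i = coord (c i) (x i).
Proof. by rewrite mulmx_block_incl mxrowK. Qed.

Lemma block_image (D : forall i, set (M i)) :
  coord (prod_chart c) @` [set x | forall i, D i (x i)] =
  [set p | forall i, (coord (c i) @` D i) (p *m E i)].
Proof.
apply/seteqP; split => p.
  by move=> [x Dx <-] i; rewrite coord_block; exists (x i).
move=> pD; have pD' i : exists2 y, D i y & coord (c i) y = p *m E i by exact: pD.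
exists (fun i => sval (cid2 (pD' i))).
  by move=> i; case: cid2.
apply/mxrowP => i; rewrite mxrowK -mulmx_block_incl.
by case: cid2.
Qed.

Lemma prod_is_chart : is_chart (prod_chart c).
Proof.
have oc : open (dom (prod_chart c)).
  by apply: (open_box (A := fun i => dom (c i))) => i; case: (ch i).
have ocod : open (cod (prod_chart c)).
  rewrite /cod (block_image (fun i => dom (c i))).
  apply: (open_block_box (A := fun i => cod (c i))) => i.
  by case: (ch i).
split => //.
- move=> x dx; apply: functional_extensionality_dep => i /=.
  by rewrite -mulmx_block_incl coord_block; case: (ch i) => _ _ + _ _; apply.
- rewrite continuous_open_subspace// => x; rewrite inE => dx.
  have -> : coord (prod_chart c) =
      (\sum_i (fun x : PM => coord (c i) (x i) *m (E i)^T) :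
      PM -> 'rV[R]_(\sum_i dim i)).
    by apply/funext => y; rewrite fct_sumE -mxrow_block_sum.
  apply: continuous_sum => i.
  apply: (@continuous_comp _ _ _
    (coord (c i) \o (fun x : PM => x i)) (mulmx^~ (E i)^T)).
      apply: continuous_comp; first exact: cproj.
      case: (ch i) => od _ _ + _; rewrite continuous_open_subspace//.
      by apply; rewrite inE; exact: dx.
    exact: continuous_mulmxr.
- rewrite continuous_open_subspace// => p; rewrite inE => dp.
  apply: continuous_into_prod => i.
  have -> : (fun y => point (prod_chart c) y i) =
      point (c i) \o (fun q => q *m E i).
    by apply/funext => q /=; rewrite mulmx_block_incl.
  apply: continuous_comp; first exact: continuous_mulmxr.
  case: (ch i) => _ occ _ _; rewrite continuous_open_subspace//; apply.
  by rewrite inE; move: dp; rewrite /cod (block_image (fun i => dom (c i))); exact.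
Qed.

Lemma prod_metricE p :
  metric (prod_chart c) p = block_diag (fun i => metric (c i) (p *m E i)).
Proof.
rewrite -mxdiag_block_sum; apply: eq_mxdiag => i /=.
by rewrite mulmx_block_incl.
Qed.

Lemma prod_codE : cod (prod_chart c) = [set p | forall i, cod (c i) (p *m E i)].
Proof. exact: (block_image (fun i => dom (c i))). Qed.

Lemma prod_metric_C1 : class_C 1 (cod (prod_chart c)) (metric (prod_chart c)).
Proof.
have -> : metric (prod_chart c) =
      (\sum_i (fun p => E i *m metric (c i) (p *m E i) *m (E i)^T) :
      'rV[R]_(\sum_i dim i) -> 'M[R]_(\sum_i dim i)).
  by apply/funext => p; rewrite fct_sumE prod_metricE.
apply: class_C1_sum; first by case: prod_is_chart.
  move=> i; have := class_C1_sandwich (E i) (E i)^T (E i) _ (C1_metric (HS i) (cS i)).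
  have [_ oci _ _ _] := ch i.
  move=> /(_ oci); apply: class_C1_subset.
  by rewrite prod_codE => p; exact.
Qed.

Lemma prod_metric_sym p : cod (prod_chart c) p ->
  (metric (prod_chart c) p)^T = metric (prod_chart c) p.
Proof.
rewrite prod_codE => cp; rewrite prod_metricE tr_block_diag /block_diag.
by apply: eq_bigr => i _; rewrite (C1_metric_sym (HS i) (cS i)).
Qed.

Lemma prod_metric_pos p (v : 'rV[R]_(\sum_i dim i)) : cod (prod_chart c) p ->
  v != 0 -> 0 < (v *m metric (prod_chart c) p *m v^T) 0 0.
Proof.
rewrite prod_codE => cp v0; rewrite prod_metricE block_diag_form.
have pos i (w : 'rV[R]_(dim i)) : w != 0 ->
    0 < (w *m metric (c i) (p *m E i) *m w^T) 0 0.
  by move=> w0; apply: (C1_metric_pos (HS i)).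
have ge0 i (w : 'rV[R]_(dim i)) : 0 <= (w *m metric (c i) (p *m E i) *m w^T) 0 0.
  by have [->|/pos/ltW//] := eqVneq w 0; rewrite mul0mx mul0mx mxE.
rewrite lt_neqAle sumr_ge0 ?andbT// eq_sym psumr_eq0//.
apply: contra v0 => /allP v0; apply/eqP/mxrowP => i; rewrite submxrow0.
apply/eqP; apply: contraT => vi0; have := v0 i (mem_index_enum _).
by rewrite gt_eqF ?pos.
Qed.
End ProductChart.

Section ProductTransition.
Variables c d : forall i, chart R (dim i) (M i).
Hypothesis cS : forall i, atlas (S i) (c i).
Arguments cS : clear implicits.
Hypothesis dS : forall i, atlas (S i) (d i).
Arguments dS : clear implicits.

Lemma prod_transitionE : transition (prod_chart c) (prod_chart d) =
  \sum_i (fun p => 1%:M *m transition (c i) (d i) (p *m E i) *m (E i)^T).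
Proof.
apply/funext => p; rewrite fct_sumE /transition/= mxrow_block_sum.
by apply: eq_bigr => i _; rewrite mul1mx mulmx_block_incl.
Qed.

Let trC1 i : class_C 1 [set p | (coord (c i) @` (dom (c i) `&` dom (d i))) p]
  (transition (c i) (d i)).
Proof. exact: (C1_transition (HS i) (cS i) (dS i)). Qed.
Arguments trC1 : clear implicits.

Lemma open_overlap i : open (coord (c i) @` (dom (c i) `&` dom (d i))).
Proof.
have [od _ _ _ _] := C1_chart (HS i) (dS i).
by apply: chart_open_image od; exact: (C1_chart (HS i) (cS i)).
Qed.

Lemma prod_transition_C1 :
  class_C 1 (coord (prod_chart c) @` (dom (prod_chart c) `&` dom (prod_chart d)))
    (transition (prod_chart c) (prod_chart d)).
Proof.
have -> : dom (prod_chart c) `&` dom (prod_chart d) =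
    [set x | forall i, (dom (c i) `&` dom (d i)) (x i)].
  apply/seteqP; split => x /=; first by move=> [cx dx] i; split; [exact: cx|exact: dx].
  by move=> cdx; split => i; have [] := cdx i.
rewrite (block_image c (fun i => dom (c i) `&` dom (d i))) prod_transitionE.
apply: class_C1_sum.
  apply: (open_block_box (A := fun i => coord (c i) @` (dom (c i) `&` dom (d i)))).
  exact: open_overlap.
move=> i.
have := class_C1_sandwich 1%:M (E i)^T (E i) (open_overlap (i := i)) (trC1 i).
by apply: class_C1_subset => p; exact.
Qed.

Lemma prod_jacobian (x : PM) : dom (prod_chart c) x -> dom (prod_chart d) x ->
  'J (transition (prod_chart c) (prod_chart d)) (coord (prod_chart c) x) =
  block_diag (fun i => 'J (transition (c i) (d i)) (coord (c i) (x i))).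
Proof.
move=> cx dx; have [dt _] := prod_transition_C1.
apply: eq_mulmx_rV => v; rewrite -deriveEjacobian; last first.
  by apply: dt; exists x.
have di i : differentiable (transition (c i) (d i)) (coord (prod_chart c) x *m E i).
  apply: (trC1 i).1; rewrite coord_block; exists (x i) => //.
have ds i := @differentiable_sandwich _ _ _ _ _ _ _
  (transition (c i) (d i)) (1%:M : 'M[R]_1) (E i)^T (E i) _ (di i).
rewrite prod_transitionE derive_sum => [|i]; last exact/diff_derivable/(ds i).1.
rewrite mulmx_sumr; apply: eq_bigr => i _; rewrite (ds i).2 mul1mx.
by rewrite deriveEjacobian// coord_block !mulmxA.
Qed.

Lemma prod_metric_law (x : PM) : dom (prod_chart c) x -> dom (prod_chart d) x ->
  let J := 'J (transition (prod_chart c) (prod_chart d)) (coord (prod_chart c) x) in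
  metric (prod_chart c) (coord (prod_chart c) x) =
  J *m metric (prod_chart d) (coord (prod_chart d) x) *m J^T.
Proof.
move=> cx dx J; rewrite {}/J prod_jacobian// !prod_metricE tr_block_diag !block_diagM.
rewrite /block_diag; apply: eq_bigr => i _; rewrite !coord_block.
by congr (_ *m _ *m _); exact: (C1_metric_law (HS i) (cS i) (dS i) (cx i) (dx i)).
Qed.
End ProductTransition.

Lemma prod_riemannian_C1 : C1_riemannian (prod_riemannian S).
Proof.
split.
- by apply: second_countable_prod => i; exact: C1_second_countable (HS i).
- by move=> _ [c cS <-]; exact: prod_is_chart.
- by move=> _ [c cS <-]; exact: prod_metric_C1.
- by move=> _ p [c cS <-]; exact: prod_metric_sym.
- by move=> _ p v [c cS <-]; exact: prod_metric_pos.
- move=> x; split; last by move=> i; have [] := C1_chart_at (HS i) (x i).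
  by exists (fun i => chart_at (S i) (x i)) => // i;
    have [] := C1_chart_at (HS i) (x i).
- by move=> _ _ [c cS <-] [d dS <-]; exact: prod_transition_C1.
- by move=> _ _ x [c cS <-] [d dS <-] cx dx; exact: prod_metric_law.
Qed.

End ProductManifold.

(** * Measurable orthonormalization *)

Section MeasurableMatrices.
Context d (T : measurableType d) (R : realType) (D : set T).

Definition mx_measurable m n (A : T -> 'M[R]_(m, n)) : Prop :=
  forall i j, measurable_fun D (fun x => A x i j).

Lemma mx_measurable_mul m n p (A : T -> 'M[R]_(m, n)) (B : T -> 'M[R]_(n, p)) :
  mx_measurable A -> mx_measurable B -> mx_measurable (fun x => A x *m B x).
Proof.
move=> mA mB i j; under eq_fun do rewrite mxE.
by apply: measurable_sum => k; exact: measurable_funM.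
Qed.

Lemma mx_measurable_tr m n (A : T -> 'M[R]_(m, n)) :
  mx_measurable A -> mx_measurable (fun x => (A x)^T).
Proof. by move=> mA i j; under eq_fun do rewrite mxE; exact: mA. Qed.

Lemma mx_measurable_scale m n (a : T -> R) (A : T -> 'M[R]_(m, n)) :
  measurable_fun D a -> mx_measurable A -> mx_measurable (fun x => a x *: A x).
Proof.
by move=> ma mA i j; under eq_fun do rewrite mxE; exact: measurable_funM.
Qed.

Lemma mx_measurableB m n (A B : T -> 'M[R]_(m, n)) :
  mx_measurable A -> mx_measurable B -> mx_measurable (fun x => A x - B x).
Proof.
by move=> mA mB i j; under eq_fun do rewrite 2!mxE; exact: measurable_funB.
Qed.

Lemma mx_measurable_row m n (A : T -> 'M[R]_(m, n)) k :
  mx_measurable A -> mx_measurable (fun x => row k (A x)).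
Proof. by move=> mA i j; under eq_fun do rewrite mxE; exact: mA. Qed.

Lemma mx_measurable_block m1 m2 n1 n2 (A : T -> 'M[R]_(m1, n1))
    (B : T -> 'M[R]_(m1, n2)) (C : T -> 'M[R]_(m2, n1)) (E : T -> 'M[R]_(m2, n2)) :
  mx_measurable A -> mx_measurable B -> mx_measurable C -> mx_measurable E ->
  mx_measurable (fun x => block_mx (A x) (B x) (C x) (E x)).
Proof.
move=> mA mB mC mE i j; rewrite -(splitK i) -(splitK j).
case: (fintype.split i) => i'; case: (fintype.split j) => j' /=.
- by under eq_fun do rewrite block_mxEul; exact: mA.
- by under eq_fun do rewrite block_mxEur; exact: mB.
- by under eq_fun do rewrite block_mxEdl; exact: mC.
- by under eq_fun do rewrite block_mxEdr; exact: mE.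
Qed.

Lemma mx_measurable_cst m n (A : 'M[R]_(m, n)) : mx_measurable (fun=> A).
Proof. by move=> i j; exact: measurable_cst. Qed.

(** Measurable choice of orthonormal bases for a family of scalar products, by
    induction on the dimension: normalize the first vector, then continue with
    the Schur complement [S]. The power function provides the inverse square
    root, as it is measurable on the whole line. *)
Lemma measurable_orthonormalization n (g : T -> 'M[R]_n) : mx_measurable g ->
  exists A : T -> 'M[R]_n, mx_measurable A /\
    forall x, (g x)^T = g x ->
      (forall v : 'rV[R]_n, v != 0 -> 0 < (v *m g x *m v^T) 0 0) ->
      A x *m g x *m (A x)^T = 1%:M.
Proof.
elim: n g => [|n IH] g mg.
  exists (fun=> 0); split => [i []//|x _ _].
  by apply/matrixP => -[].
pose gb x : 'M[R]_(1 + n) := g x.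
pose a x := ulsubmx (gb x) 0 0.
pose b x := ursubmx (gb x).
pose s x := a x `^ (- 2^-1).
pose S x := drsubmx (gb x) - (s x ^+ 2) *: ((b x)^T *m b x).
have ma : measurable_fun D a.
  by rewrite /a; under eq_fun do rewrite !mxE; exact: mg.
have mb : mx_measurable b.
  by move=> i j; rewrite /b; under eq_fun do rewrite !mxE; exact: mg.
have ms : measurable_fun D s.
  exact: (measurableT_comp (measurable_powR (- 2^-1)) ma).
have ms2 : measurable_fun D (fun x => s x ^+ 2).
  exact: measurable_funX.
have mS : mx_measurable S.
  apply: mx_measurableB.
    by move=> i j; under eq_fun do rewrite !mxE; exact: mg.
  apply: mx_measurable_scale => //; apply: mx_measurable_mul => //.
  exact: mx_measurable_tr.
have [A' [mA' A'P]] := IH S mS.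
pose A x : 'M[R]_(1 + n) := block_mx (s x *: 1%:M) 0
   ((- (s x ^+ 2)) *: (A' x *m (b x)^T)) (A' x).
exists A; split.
  apply: (@mx_measurable_block 1 n 1 n) => //.
  - by apply: mx_measurable_scale => //; exact: mx_measurable_cst.
  - apply: mx_measurable_scale; first exact: measurable_funN.
    by apply: mx_measurable_mul => //; exact: mx_measurable_tr.
move=> x gsym gpos.
have gbs : (gb x)^T = gb x := gsym.
have gbpos : forall v : 'rV[R]_(1 + n), v != 0 -> 0 < (v *m gb x *m v^T) 0 0 := gpos.
suff : A x *m gb x *m (A x)^T = 1%:M by [].
have gE : gb x = block_mx ((a x)%:M) (b x) (b x)^T (drsubmx (gb x)).
  rewrite -[LHS]submxK; congr block_mx; first exact: mx11_scalar.
  by rewrite /b trmx_ursub gbs.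
have Dsym : (drsubmx (gb x))^T = drsubmx (gb x).
  by rewrite trmx_drsub gbs.
have a0 : 0 < a x.
  have v0 : (row_mx (1%:M : 'M[R]_1) (0 : 'rV[R]_n) : 'rV[R]_(1 + n)) != 0.
    apply/eqP => /(congr1 lsubmx); rewrite row_mxKl => /matrixP/(_ 0 0).
    by rewrite !mxE => /eqP; rewrite mulr1n oner_eq0.
  have := gbpos _ v0; rewrite gE mul_row_block tr_row_mx mul_row_col.
  by rewrite trmx0 mulmx0 addr0 mul0mx addr0 mul1mx trmx1 mulmx1 mxE mulr1n.
have s2a : s x ^+ 2 * a x = 1.
  rewrite expr2 -powRD; last by rewrite (gt_eqF a0) ?implybT ?orbT.
  have -> : - 2^-1 + - 2^-1 = -1 :> R by field.
  by rewrite powR_inv1 ?ltW// mulVf// gt_eqF.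
have Ssym : (S x)^T = S x.
  by rewrite /S linearB linearZ/= trmx_mul trmxK Dsym.
have Spos (w : 'rV[R]_n) : w != 0 -> 0 < (w *m S x *m w^T) 0 0.
  move=> w0; pose r := - (s x ^+ 2) *: (w *m (b x)^T).
  have v0 : (row_mx r w : 'rV[R]_(1 + n)) != 0.
    by apply: contra w0 => /eqP/(congr1 rsubmx); rewrite row_mxKr linear0 => ->.
  have := gbpos _ v0; rewrite gE mul_row_block tr_row_mx mul_row_col.
  have -> : r *m (a x)%:M + w *m (b x)^T = 0.
    rewrite mul_mx_scalar /r scalerA mulrN mulrC s2a scaleN1r.
    by rewrite addrC subrr.
  rewrite mul0mx add0r; congr (0 < fun_of_matrix _ _ _).
  congr (_ *m _); rewrite /S mulmxBr /r -scalemxAl -mulmxA -scalemxAr.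
  by rewrite scaleNr addrC.
have A'1 := A'P x Ssym Spos.
rewrite gE /A tr_block_mx trmx0 !mulmx_block.
rewrite !mul0mx !mulmx0 !addr0 ![(_ *: _)^T]linearZ/= trmx1 trmx_mul trmxK.
have e1 : - s x ^+ 2 *: (A' x *m (b x)^T) *m (a x)%:M + A' x *m (b x)^T = 0.
  rewrite mul_mx_scalar scalerA mulrN mulrC s2a scaleN1r.
  by rewrite addrC subrr.
have e2 : - s x ^+ 2 *: (A' x *m (b x)^T) *m b x + A' x *m drsubmx (gb x) =
    A' x *m S x.
  by rewrite /S mulmxBr -scalemxAl -mulmxA -scalemxAr scaleNr addrC.
rewrite e1 e2 A'1 !mul0mx !add0r.
have -> : s x *: 1%:M *m (a x)%:M *m (s x *: 1%:M) = 1%:M :> 'M[R]_1.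
  rewrite -scalemxAl mul1mx -scalemxAl -scalemxAr mulmx1 scalerA -expr2.
  by rewrite scale_scalar_mx s2a.
have -> : s x *: 1%:M *m (a x)%:M *m (- s x ^+ 2 *: (b x *m (A' x)^T)) +
   s x *: 1%:M *m b x *m (A' x)^T = 0.
  rewrite -!scalemxAl !mul1mx mul_scalar_mx !scalerA.
  have -> : s x * a x * - s x ^+ 2 = - s x.
    by rewrite mulrN -mulrA [a x * _]mulrC s2a mulr1.
  by rewrite scaleNr addNr.
by rewrite -scalar_mx_block.
Qed.

End MeasurableMatrices.

(** * Changes of charts *)

(** Transition maps compose only on the overlap of the domains of three charts,
    hence the equality near [p]. *)
Lemma jacobian_near_comp (R : realType) m n k (f : 'rV[R]_m -> 'rV[R]_n)
    (g : 'rV[R]_n -> 'rV[R]_k) (h : 'rV[R]_m -> 'rV[R]_k) p :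
  differentiable f p -> differentiable g (f p) -> differentiable h p ->
  (\forall q \near p, g (f q) = h q) -> 'J h p = 'J f p *m 'J g (f p).
Proof.
move=> df dg dh gfh; apply: eq_mulmx_rV => v.
rewrite mulmxA -(deriveEjacobian v dh) -(deriveEjacobian v df).
rewrite -(deriveEjacobian _ dg).
have dgf : differentiable (g \o f) p by exact: differentiable_comp.
have H : is_derive p v (g \o f) ('D_('D_v f p) g (f p)).
  apply: DeriveDef; first exact: diff_derivable.
  by rewrite !deriveE// diff_comp.
by have [_ ->] := near_eq_is_derive gfh H.
Qed.

Section ChartChange.
Variables (R : realType) (n : nat) (M : topologicalType).
Variable S : riemannianData R n M.
Hypothesis HS : C1_riemannian S.
Implicit Types (c d a : chart R n M) (x y : M).

Lemma coord_continuous_at c x : atlas S c -> dom c x ->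
  {for x, continuous (coord c)}.
Proof.
move=> cS cx; have [oc _ _ cc _] := C1_chart HS cS.
by rewrite continuous_open_subspace// in cc; apply: cc; rewrite inE.
Qed.

Lemma transition_coord c d x : atlas S c -> dom c x ->
  transition c d (coord c x) = coord d x.
Proof.
by move=> cS cx; have [_ _ pK _ _] := C1_chart HS cS; rewrite /transition/= pK.
Qed.

Lemma transition_differentiable c d x : atlas S c -> atlas S d ->
  dom c x -> dom d x -> differentiable (transition c d) (coord c x).
Proof.
by move=> cS dS cx dx; apply: (C1_transition HS cS dS).1; exists x.
Qed.

Lemma jacobian_id c x : atlas S c -> dom c x ->
  'J (transition c c) (coord c x) = 1%:M.
Proof.
move=> cS cx; apply: eq_mulmx_rV => v.
rewrite -deriveEjacobian ?mulmx1; last exact: transition_differentiable.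
have [_ occ pK _ _] := C1_chart HS cS.
suff H : is_derive (coord c x) v (transition c c) v by rewrite derive_val.
apply: near_eq_is_derive (is_derive_id _ _).
have : \forall q \near coord c x, cod c q.
  by apply: open_nbhs_nbhs; split => //; exists x.
by apply: filterS => _ [z cz <-]; rewrite transition_coord.
Qed.

Lemma jacobian_cocycle a c d x : atlas S a -> atlas S c -> atlas S d ->
  dom a x -> dom c x -> dom d x ->
  'J (transition a d) (coord a x) =
  'J (transition a c) (coord a x) *m 'J (transition c d) (coord c x).
Proof.
move=> aS cS dS ax cx dx.
have dac := transition_differentiable aS cS ax cx.
have dcd := transition_differentiable cS dS cx dx.
have dad := transition_differentiable aS dS ax dx.
rewrite -(transition_coord c aS ax) in dcd *.
apply: jacobian_near_comp => //.
have : \forall q \near coord a x, (coord a @` (dom a `&` dom c)) q.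
  apply: open_nbhs_nbhs; split; last by exists x.
  apply: chart_open_image; first exact: (C1_chart HS aS).
  by have [] := C1_chart HS cS.
apply: filterS => _ [z [az cz] <-].
by rewrite (transition_coord _ aS az) (transition_coord _ cS cz) transition_coord.
Qed.

Lemma jacobian_continuous c d x i j : atlas S c -> atlas S d ->
  dom c x -> dom d x ->
  {for x, continuous (fun y => ('J (transition c d) (coord c y)) i j)}.
Proof.
move=> cS dS cx dx; have [_ /(_ 'e_i) cD] := C1_transition HS cS dS.
have c1 : {for x, continuous ((fun N : 'rV[R]_n => N 0 j) \o
    ('D_('e_i) (transition c d) \o coord c))}.
  apply: continuous_comp; last exact: coord_continuous.
  apply: continuous_comp; first exact: coord_continuous_at.
  by apply: cD; exists x.
have near_eq : \forall y \near x, 'D_('e_i) (transition c d) (coord c y) 0 j =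
    ('J (transition c d) (coord c y)) i j.
  have : \forall y \near x, dom c y /\ dom d y.
    by apply: filterI; apply: open_nbhs_nbhs; split => //;
      [have [] := C1_chart HS cS|have [] := C1_chart HS dS].
  apply: filterS => y [cy dy].
  rewrite deriveEjacobian; last exact: transition_differentiable.
  by rewrite -rowE mxE.
exact: (near_eq_continuous near_eq c1).
Qed.

Lemma metric_continuous c x i j : atlas S c -> dom c x ->
  {for x, continuous (fun y => (metric c (coord c y)) i j)}.
Proof.
move=> cS cx; have [dm _] := C1_metric HS cS.
have : {for x, continuous ((fun N : 'M[R]_n => N i j) \o (metric c \o coord c))}.
  apply: continuous_comp; last exact: coord_continuous.
  apply: continuous_comp; first exact: coord_continuous_at.
  by apply: differentiable_continuous; apply: dm; exists x.
exact.
Qed.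

(** Lindelof: a chart domain around each point contains a basic open set. *)
Lemma countable_charts (x0 : M) : exists c : nat -> chart R n M,
  (forall k, atlas S (c k)) /\ forall x, exists k, dom (c k) x.
Proof.
have [e [eo en]] := second_countable_seq (C1_second_countable HS).
have /choice[c cP] k : exists c : chart R n M, atlas S c /\
    ((exists x, e k `<=` dom (chart_at S x)) -> e k `<=` dom c).
  have [[x ex]|nex] := pselect (exists x, e k `<=` dom (chart_at S x)).
    by exists (chart_at S x); split => //; case: (C1_chart_at HS x).
  by exists (chart_at S x0); split => //; case: (C1_chart_at HS x0).
exists c; split => [k|x]; first by case: (cP k).
have [aS ax] := C1_chart_at HS x; have [oa _ _ _ _] := C1_chart HS aS.
have [k [ekx ekd]] := en x _ (open_nbhs_nbhs (conj oa ax)).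
by exists k; apply: (cP k).2 => //; exists x.
Qed.

End ChartChange.

(** * Borel measurability on manifolds and tangent bundles *)

(** An alias of [T] with the sigma-algebra that [G] generates; the point [t0] is
    part of it because measurable types are pointed. *)
Definition gen_sigma_type (T : choiceType) (t0 : T) (G : set (set T)) : Type := T.

Section BorelTypes.
Variables (T : choiceType) (t0 : T) (G : set (set T)).
Local Notation gT := (gen_sigma_type t0 G).

HB.instance Definition _ := Choice.on gT.
HB.instance Definition _ := isPointed.Build gT t0.
Lemma generated0 : <<s G >> (set0 : set gT). Proof. exact: sigma_algebra0. Qed.
Lemma generatedC (A : set gT) : <<s G >> A -> <<s G >> (~` A).
Proof. by move=> GA; rewrite -setTD; exact: sigma_algebraCD. Qed.
Lemma generated_bigcup (F : (set gT)^nat) :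
  (forall i, <<s G >> (F i)) -> <<s G >> (\bigcup_i F i).
Proof. exact: sigma_algebra_bigcup. Qed.
HB.instance Definition _ := @isMeasurable.Build (sigma_display G) gT <<s G >>
  generated0 generatedC generated_bigcup.
End BorelTypes.

Section BoxMeasurable.
Context (R : realType).

Lemma open_rat_box (m n : nat) (O : set ('rV[R]_m * 'rV[R]_n)) p : open O -> O p ->
  exists (q : 'rV[rat]_m * 'rV[rat]_n * nat),
    let box := [set z : 'rV[R]_m * 'rV[R]_n |
      (forall i, `|z.1 0 i - ratr (q.1.1 0 i)| < q.2.+1%:R^-1) /\
      (forall i, `|z.2 0 i - ratr (q.1.2 0 i)| < q.2.+1%:R^-1)] in
    box p /\ box `<=` O.
Proof.
move=> oO Op; have /nbhs_ballP[e /= e0 eO] : nbhs p O by exact: open_nbhs_nbhs.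
have [k ke] : exists k : nat, k.+1%:R^-1 < e / 2.
  have e2 : 0 < e / 2 by rewrite divr_gt0.
  have [k _ /(_ k (leqnn k)) /= ke] := near_infty_natSinv_lt (PosNum e2).
  by exists k.
have rat_near (x : R) : exists q : rat, `|x - ratr q| < k.+1%:R^-1.
  have xk : x - k.+1%:R^-1 < x + k.+1%:R^-1 by rewrite ltrD2l gtrN.
  have [q] := rat_in_itvoo xk; rewrite in_itv/= => /andP[q1 q2].
  exists q; move: q1 q2; rewrite ltr_norml; set z := _^-1; set r := ratr q.
  by move=> q1 q2; apply/andP; split; lra.
have /choice[q1 q1P] i : exists q : rat, `|p.1 0 i - ratr q| < k.+1%:R^-1 by [].
have /choice[q2 q2P] i : exists q : rat, `|p.2 0 i - ratr q| < k.+1%:R^-1 by [].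
exists (\row_i q1 i, \row_i q2 i, k) => /=; split.
  by split => i; rewrite mxE.
have close (x y z : R) : `|x - z| < k.+1%:R^-1 -> `|y - z| < k.+1%:R^-1 ->
    `|x - y| < e.
  move=> xz yz; rewrite (splitr e) -(subrKA z) (le_lt_trans (ler_normD _ _))//.
  rewrite ltrD//; first exact: (lt_trans xz ke).
  by rewrite distrC; exact: (lt_trans yz ke).
move=> z /= [z1 z2]; apply: eO; split; split=> // i j; rewrite (ord1 i).
  by apply: (close _ _ _ (q1P j)); have := z1 j; rewrite mxE.
by apply: (close _ _ _ (q2P j)); have := z2 j; rewrite mxE.
Qed.

(** An open set is a countable union of boxes with rational centres, so that
    measurability of the entries suffices. *)
Lemma measurable_open_pair d (T : measurableType d) (D : set T) (m n : nat)
    (h1 : T -> 'rV[R]_m) (h2 : T -> 'rV[R]_n) (O : set ('rV[R]_m * 'rV[R]_n)) :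
  measurable D -> mx_measurable D h1 -> mx_measurable D h2 -> open O ->
  measurable (D `&` [set x | O (h1 x, h2 x)]).
Proof.
move=> mD m1 m2 oO.
pose box (q : 'rV[rat]_m * 'rV[rat]_n * nat) := [set z : 'rV[R]_m * 'rV[R]_n |
      (forall i, `|z.1 0 i - ratr (q.1.1 0 i)| < q.2.+1%:R^-1) /\
      (forall i, `|z.2 0 i - ratr (q.1.2 0 i)| < q.2.+1%:R^-1)].
pose F q := if `[< box q `<=` O >] then D `&` [set x | box q (h1 x, h2 x)] else set0.
have -> : D `&` [set x | O (h1 x, h2 x)] = \bigcup_q F q.
  apply/seteqP; split => x /=.
    move=> [Dx Ox]; have [q [qx qO]] := open_rat_box oO Ox.
    by exists q => //; rewrite /F; case: asboolP.
  by move=> [q _]; rewrite /F; case: asboolP => // qO [Dx /qO].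
apply: countable_bigcupT_measurable => [|q]; first exact: countableP.
rewrite /F; case: asboolP => _ //.
have near_measurable k (h : T -> 'rV[R]_k) (r : 'rV[rat]_k) (l : nat) :
    mx_measurable D h ->
    measurable (D `&` [set x | forall i, `|h x 0 i - ratr (r 0 i)| < l.+1%:R^-1]).
  move=> mh.
  have -> : D `&` [set x | forall i, `|h x 0 i - ratr (r 0 i)| < l.+1%:R^-1] =
      D `&` \bigcap_(i in [set: 'I_k])
        (D `&` (fun x => h x 0 i) @^-1`
           `](ratr (r 0 i) - l.+1%:R^-1), (ratr (r 0 i) + l.+1%:R^-1)[%classic).
    apply/seteqP; split => x /= [Dx hx]; split => // i.
      move=> _; split => //=; rewrite in_itv/=; have := hx i.
      by rewrite ltr_distl.
    have [_ /=] := hx i I; by rewrite in_itv/= ltr_distl.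
  apply: measurableI => //; apply: fin_bigcap_measurable => [|i _].
    exact: finite_finset.
  by apply: mh.
have -> : D `&` [set x | box q (h1 x, h2 x)] =
   (D `&` [set x | forall i, `|h1 x 0 i - ratr (q.1.1 0 i)| < q.2.+1%:R^-1]) `&`
   (D `&` [set x | forall i, `|h2 x 0 i - ratr (q.1.2 0 i)| < q.2.+1%:R^-1]).
  by apply/seteqP; split => x /=; rewrite /box/=; [case=> ? []|case=> [[? ?] [? ?]]].
by apply: measurableI; exact: near_measurable.
Qed.
End BoxMeasurable.

Lemma form_row (R : comPzRingType) n (v : 'rV[R]_n) (G A : 'M[R]_n) j :
  (v *m G *m (row j A)^T) 0 0 = (v *m G *m A^T) 0 j.
Proof. by rewrite mxE [RHS]mxE; apply: eq_bigr => l _; rewrite !mxE. Qed.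

Lemma orthonormal_form (R : comUnitRingType) n (v w : 'rV[R]_n) (G A : 'M[R]_n) :
  A *m G *m A^T = 1%:M -> G^T = G ->
  \sum_j (v *m G *m A^T) 0 j * (w *m G *m A^T) 0 j = (v *m G *m w^T) 0 0.
Proof.
move=> A1 Gs.
transitivity ((v *m G *m A^T *m (w *m G *m A^T)^T) 0 0).
  by rewrite [RHS]mxE; apply: eq_bigr => j _; congr (_ * _); rewrite [RHS]mxE.
have AA : A^T *m (A *m G) = 1%:M by exact: mulmx1C A1.
by rewrite !trmx_mul trmxK Gs -!mulmxA (mulmxA A G) (mulmxA A^T) AA mul1mx.
Qed.

Section BorelFrame.
Variables (R : realType) (n : nat) (M : topologicalType).
Variable S : riemannianData R n M.
Hypothesis HS : C1_riemannian S.
Variable x0 : M.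

(** By construction the measurable sets of [borelM] and [borelTM] are those of
    [M_borel] and [TM_borel S]. *)
Definition borelM : Type := @gen_sigma_type M x0 [set A : set M | open A].
HB.instance Definition _ := Measurable.on borelM.
Definition borelTM : Type := @gen_sigma_type (M * 'rV[R]_n)%type (x0, 0) (bundle_open S).
HB.instance Definition _ := Measurable.on borelTM.

Lemma borelM_open (U : set M) : open U -> @measurable _ borelM U.
Proof. by move=> oU; exact: sub_sigma_algebra. Qed.

Lemma borelM_continuous (U : set M) (f : M -> R) : open U ->
  (forall x, U x -> {for x, continuous f}) ->
  @measurable_fun _ _ borelM R U f.
Proof.
move=> oU cf; apply: (measurability _ (RGenOpens.measurableE R)).
move=> _ [V [a [b ->]] <-].
have oUV : open (U `&` f @^-1` `]a, b[%classic).
  rewrite openE => x [Ux fx]; rewrite /interior; apply: filterI.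
    exact: open_nbhs_nbhs.
  by apply: (cf x Ux); apply: open_nbhs_nbhs; split => //; exact: interval_open.
exact: borelM_open.
Qed.

Lemma borelTM_dom c : atlas S c ->
  @measurable _ borelTM [set yv : M * 'rV[R]_n | dom c yv.1].
Proof.
move=> cS; apply: sub_sigma_algebra; exists c, setT; split => //.
  exact: openT.
by apply/seteqP; split => yv //= [].
Qed.

Lemma borelTM_to_chart c : atlas S c ->
  @mx_measurable _ borelTM R [set yv : M * 'rV[R]_n | dom c yv.1] _ _
    (fun yv => to_chart S yv.1 c yv.2).
Proof.
move=> cS i j; rewrite (ord1 i).
apply: (measurability _ (RGenOpens.measurableE R)).
move=> _ [V [a [b ->]] <-].
apply: sub_sigma_algebra.
exists c, [set pv | `]a, b[%classic ((pv.2 : 'rV[R]_n) 0 j)]; split => //.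
rewrite openE => pv /= pvab; rewrite /interior.
have cN : {for pv, continuous ((fun N : 'rV[R]_n => N 0 j) \o snd)}.
  apply: continuous_comp; last exact: coord_continuous.
  exact: cvg_snd.
by apply: (cN `]a, b[%classic); apply: open_nbhs_nbhs; split => //; exact: interval_open.
Qed.

(** Over one chart, the preimage of an open set is a basic open set of the
    bundle; countably many charts suffice. *)
Lemma borelTM_fst : @measurable_fun _ _ borelTM borelM setT fst.
Proof.
apply: (@measurability _ _ borelTM borelM setT fst [set A | open A]) => //.
move=> _ [U oU <-]; rewrite setTI.
have [c [cS cov]] := countable_charts HS x0.
have -> : fst @^-1` U = \bigcup_k [set yv : M * 'rV[R]_n | dom (c k) yv.1 /\
    (coord (c k) @` (dom (c k) `&` U)) (coord (c k) yv.1)].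
  apply/seteqP; split => [[y v] /= Uy|[y v] [k _ /= [cy [z [cz Uz] zy]]]].
    by have [k cy] := cov y; exists k => //; split => //; exists y.
  have [_ _ pK _ _] := C1_chart HS (cS k).
  by rewrite -(pK y cy) -zy pK.
apply: bigcupT_measurable => k; apply: sub_sigma_algebra.
exists (c k), [set pv | (coord (c k) @` (dom (c k) `&` U)) pv.1]; split => //.
have oI := chart_open_image (C1_chart HS (cS k)) oU.
rewrite openE => pv pvI; rewrite /interior.
by apply: (@cvg_fst _ _ (nbhs pv.1) (nbhs pv.2) _ _); exact: open_nbhs_nbhs.
Qed.

(** Cut the manifold into the countably many pieces on which [c k] is the first
    chart, in a fixed sequence of charts, to contain the point, and orthonormalize
    the coordinate frame of [c k] on its piece. In another chart the frame is
    multiplied by a Jacobian that is continuous in the point, so that it is Borel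
    as a field. *)
Theorem borel_frame : exists W : 'I_n -> M -> 'rV[R]_n,
  [/\ forall j, borel_field S (W j),
      forall j y, norm S y (W j y) <= 1,
      forall y v w, inner S y v w =
        \sum_j inner S y v (W j y) * inner S y w (W j y) &
      forall j, @measurable_fun _ _ borelTM R setT
        (fun yv => inner S yv.1 yv.2 (W j yv.1))].
Proof.
have [c [cS cov]] := countable_charts HS x0.
have domo k : open (dom (c k)) by have [] := C1_chart HS (cS k).
have cov' y : exists k, `[< dom (c k) y >].
  by have [k cy] := cov y; exists k; exact/asboolP.
pose idx y := ex_minn (cov' y).
have idx_dom y : dom (c (idx y)) y by rewrite /idx; case: ex_minnP => k /asboolP.
pose B k : set M := [set y | idx y = k].
have BE k : B k = dom (c k) `\` \bigcup_(j in [set j | (j < k)%N]) dom (c j).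
  apply/seteqP; split => y.
    move=> <-; split; first exact: idx_dom.
    move=> [j /= + cj]; rewrite /idx; case: ex_minnP => l _ /(_ j).
    by move=> /(_ (asboolT cj)); rewrite ltnNge => ->.
  move=> [cy nj]; rewrite /B/= /idx; case: ex_minnP => l /asboolP cl.
  move=> /(_ k (asboolT cy)) lk; apply/eqP; rewrite eqn_leq lk/= leqNgt.
  by apply/negP => lk'; apply: nj; exists l.
have mB k : @measurable _ borelM (B k).
  rewrite BE; apply: measurableD; first exact: borelM_open.
  by apply: bigcup_measurable => j _; exact: borelM_open.
have Bdom k : B k `<=` dom (c k) by move=> y <-.
have Bcov : \bigcup_k B k = setT.
  by apply/seteqP; split => y // _; exists (idx y).
pose gm k (y : borelM) : 'M[R]_n := metric (c k) (coord (c k) y).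
have mg k : mx_measurable (dom (c k) : set borelM) (gm k).
  move=> i j; apply: borelM_continuous => // y cy.
  exact: (metric_continuous HS (cS k) cy).
have /choice[A AP] k := measurable_orthonormalization (mg k).
have mA k : mx_measurable (dom (c k) : set borelM) (A k) by case: (AP k).
have A1 k y : dom (c k) y -> A k y *m gm k y *m (A k y)^T = 1%:M.
  move=> cy; have [_ h] := AP k; apply: h.
    by apply: (C1_metric_sym HS (cS k)); exists y.
  by move=> v; apply: (C1_metric_pos HS (cS k)); exists y.
pose W (j : 'I_n) y : 'rV[R]_n := row j (A (idx y) y) *m
  'J (transition (c (idx y)) (chart_at S y)) (coord (c (idx y)) y).
have W_chart j y e : atlas S e -> dom e y -> to_chart S y e (W j y) =
    row j (A (idx y) y) *m 'J (transition (c (idx y)) e) (coord (c (idx y)) y).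
  move=> eS ey; have [aS ay] := C1_chart_at HS y.
  rewrite /to_chart /W -mulmxA; congr (_ *m _); apply/esym.
  exact: (jacobian_cocycle HS (cS _) aS eS (idx_dom y) ay ey).
have W_self j y : to_chart S y (c (idx y)) (W j y) = row j (A (idx y) y).
  rewrite (W_chart _ _ _ (cS _) (idx_dom y)).
  by rewrite (jacobian_id HS (cS _) (idx_dom y)) mulmx1.
have inner_W j y v : inner S y v (W j y) =
    (to_chart S y (c (idx y)) v *m gm (idx y) y *m (A (idx y) y)^T) 0 j.
  by rewrite (inner_chart HS v (W j y) (cS _) (idx_dom y)) W_self form_row.
exists W; split.
- move=> j; suff mW : @measurable_fun _ _ borelM borelTM setT (fun y => (y, W j y)).
    by move=> Y mY; have := mW measurableT Y mY; rewrite setTI.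
  apply: (@measurability _ _ borelM borelTM setT _ (bundle_open S)) => //.
  move=> _ [_ [e [U [eS oU ->]]] <-]; rewrite setTI.
  have domeo : open (dom e) by have [] := C1_chart HS eS.
  pose D k : set borelM := B k `&` dom e.
  have mD k : measurable (D k) by apply: measurableI => //; exact: borelM_open.
  have -> : (fun y => (y, W j y)) @^-1`
      [set xv | dom e xv.1 /\ U (coord e xv.1, to_chart S xv.1 e xv.2)] =
    \bigcup_k (D k `&` [set y | U (coord e y, row j (A k y) *m
                     'J (transition (c k) e) (coord (c k) y))]).
    apply/seteqP; split => y.
      move=> [ey Uy]; exists (idx y); first exact: I.
      rewrite (W_chart _ _ _ eS ey) in Uy.
      by split; [split; [exact: erefl|exact: ey]|exact: Uy].
    move=> [k _ [[By ey] Uy]]; split; first exact: ey.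
    by rewrite /= (W_chart _ _ _ eS ey) (By : idx y = k); exact: Uy.
  apply: bigcupT_measurable => k; apply: measurable_open_pair => //.
    move=> i l; rewrite (ord1 i).
    apply: (@measurable_funS _ _ borelM R (dom e)); first exact: borelM_open.
      by move=> y [].
    apply: borelM_continuous => // y ey.
    have : {for y, continuous ((fun N : 'rV[R]_n => N 0 l) \o coord e)}.
      apply: continuous_comp; first exact: (coord_continuous_at HS eS ey).
      exact: coord_continuous.
    exact.
  apply: mx_measurable_mul.
    apply: mx_measurable_row => i l.
    apply: (measurable_funS _ _ (mA k i l)); first exact: borelM_open.
    by move=> y [/Bdom].
  move=> i l.
  apply: (@measurable_funS _ _ borelM R (dom (c k) `&` dom e)).
  + by apply: measurableI; exact: borelM_open.
  + by move=> y [/Bdom].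
  + apply: borelM_continuous; first exact: openI.
    by move=> y [cy ey]; exact: (jacobian_continuous HS (cS k) eS cy ey).
- move=> j y; rewrite /norm /normsq inner_W W_self.
  rewrite (_ : (_ *m _ *m _) 0 j = 1) ?sqrtr1//.
  by rewrite -!row_mul (A1 _ _ (idx_dom y)) !mxE eqxx.
- move=> y v w; rewrite (inner_chart HS v w (cS _) (idx_dom y)).
  under eq_bigr do rewrite !inner_W.
  rewrite (orthonormal_form _ _ (A1 _ _ (idx_dom y)))//.
  apply: (C1_metric_sym HS (cS (idx y))).
  by exists y; first exact: idx_dom.
- move=> j.
  pose E k : set borelTM := fst @^-1` (B k : set borelM).
  have mE k : measurable (E k).
    by have := borelTM_fst measurableT (mB k); rewrite setTI.
  have -> : [set: borelTM] = \bigcup_k E k.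
    by apply/seteqP; split => yv // _; exists (idx yv.1).
  apply/measurable_fun_bigcup => // k.
  have E_dom : E k `<=` [set yv : M * 'rV[R]_n | dom (c k) yv.1].
    by move=> yv /Bdom.
  pose f (yv : borelTM) := to_chart S yv.1 (c k) yv.2 *m gm k yv.1 *m (A k yv.1)^T.
  have base m p (Q : borelM -> 'M[R]_(m, p)) :
      mx_measurable (dom (c k) : set borelM) Q -> mx_measurable (E k) (fun yv => Q yv.1).
    move=> mQ i l.
    apply: (@measurable_comp _ _ _ borelTM borelM R (dom (c k))
      (fun y => Q y i l) (E k) fst).
    + exact: borelM_open.
    + by move=> _ [yv /Bdom ? <-].
    + exact: mQ.
    + exact: (measurable_funS measurableT (@subsetT _ _) borelTM_fst).
  have mf : mx_measurable (E k) f.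
    apply: mx_measurable_mul; last first.
      by apply: mx_measurable_tr; exact: base.
    apply: mx_measurable_mul; last exact: base.
    move=> i l; apply: (measurable_funS _ E_dom (borelTM_to_chart (cS k) i l)).
    exact: borelTM_dom.
  apply: eq_measurable_fun (mf 0 j) => yv; rewrite inE => Ek.
  by rewrite inner_W (Ek : idx yv.1 = k).
Qed.
End BorelFrame.

(** * One step of gradient descent *)

Section InnerLinear.
Variables (R : realType) (n : nat) (M : topologicalType).
Variable S : riemannianData R n M.
Implicit Types (y : M) (v w : 'rV[R]_n).

Lemma innerBl y v v' w : inner S y (v - v') w = inner S y v w - inner S y v' w.
Proof. by rewrite /inner !mulmxBl !mxE. Qed.

Lemma innerZl y a v w : inner S y (a *: v) w = a * inner S y v w.
Proof. by rewrite /inner -!scalemxAl mxE. Qed.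

Lemma inner_suml y m (v : 'I_m -> 'rV[R]_n) w :
  inner S y (\sum_i v i) w = \sum_i inner S y (v i) w.
Proof. by rewrite /inner !mulmx_suml summxE. Qed.
End InnerLinear.

Section SquareSums.
Context d (Omega : measurableType d) (R : realType) (P : probability Omega R).

(** As [fine] sends +oo to 0, a nonzero real integral is a finite integral. *)
Lemma integrableR_fine_neq0 (h : Omega -> R) : measurable_fun setT h ->
  (forall w, 0 <= h w) -> \int[P]_w h w != 0 -> integrableR P h.
Proof.
move=> mh h0 hn0; apply/integrableP; split; first exact/measurable_EFinP.
under eq_integral do rewrite /= ger0_norm//.
rewrite ltey; apply: contra hn0 => /eqP hoo.
by rewrite /Rintegral hoo.
Qed.

Lemma sq_integrable_summand n (h : 'I_n -> Omega -> R) :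
  (forall k, measurable_fun setT (h k)) ->
  integrableR P (fun w => \sum_(k < n) h k w ^+ 2) ->
  forall k, sq_integrable P (h k).
Proof.
move=> mh ih k; split; first exact: mh.
apply: (integrableR_le _ ih) => [|w]; first exact: measurable_funX.
rewrite ger0_norm ?sqr_ge0// ger0_norm; last by apply: sumr_ge0 => ? _; exact: sqr_ge0.
by rewrite (bigD1 k)//= lerDl sumr_ge0// => ? _; exact: sqr_ge0.
Qed.

Lemma integral_sq_sum n (f : 'I_n -> Omega -> R) (g : 'I_n -> Omega -> R) :
  (forall k, sq_integrable P (f k)) -> (forall k, sq_integrable P (g k)) ->
  (\int[P]_w (\sum_(k < n) f k w * g k w)%:E =
   (\sum_(k < n) \int[P]_w (f k w * g k w))%:E)%E.
Proof.
move=> sf sg; rewrite -Rintegral_sum; last by move=> k; exact: sq_integrableM.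
rewrite /Rintegral fineK//; apply: integrable_fin_num => //.
by apply: integrableR_sum => k; exact: sq_integrableM.
Qed.

Lemma Rintegral_le_ae (V : Omega -> R) (c : R) : integrableR P V ->
  {ae P, forall w, V w <= c} -> \int[P]_w V w <= c.
Proof.
move=> iV Vc; have mV := integrableR_measurable iV.
have mmin : measurable_fun setT (fun w => Num.min (V w) c).
  exact: measurable_minr.
have imin : integrableR P (fun w => Num.min (V w) c).
  have ic : integrableR P (cst c) by exact: finite_measure_integrable_cst.
  have iV' : integrableR P (fun w => `|V w|).
    apply: (integrableR_le _ iV) => [|w]; last by rewrite normr_id.
    exact: measurableT_comp.
  have ic' : integrableR P (cst `|c|) by exact: finite_measure_integrable_cst.
  apply: (integrableR_le mmin (integrableRD iV' ic')) => w /=.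
  rewrite [leRHS]ger0_norm ?addr_ge0//.
  by rewrite /Num.min; case: ifP => _; rewrite ?lerDl ?lerDr.
rewrite (Rintegral_ae_eq mV mmin); last first.
  by apply: filterS Vc => w /min_idPl ->.
rewrite [leRHS](_ : c = \int[P]_w (cst c w)); last first.
  by rewrite Rintegral_cst//= probability_setT/= mulr1.
apply: le_Rintegral => //; first exact: finite_measure_integrable_cst.
by move=> w _ /=; rewrite ge_min lexx orbT.
Qed.
End SquareSums.

Section RandomTangents.
Context (R : realType) (n : nat) (M : topologicalType).
Variable S : riemannianData R n M.
Hypothesis HS : C1_riemannian S.
Variable x0 : M.
Context d (Omega : measurableType d) (P : probability Omega R).
Variable x : Omega -> M.

Lemma random_tangent_measurable (v : Omega -> 'rV[R]_n) : random_tangent S x v ->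
  @measurable_fun _ _ Omega (borelTM S x0) setT (fun w => (x w, v w)).
Proof. by move=> rv _ B mB; rewrite setTI; exact: rv. Qed.

Lemma sigma_of_sigma_algebra : sigma_algebra setT (sigma_of x).
Proof.
apply: sigma_algebra_preimage.
exact: (smallest_sigma_algebra setT [set A : set M | open A]).
Qed.

Lemma sigma_of_measurable (v : Omega -> 'rV[R]_n) : random_tangent S x v ->
  sigma_of x `<=` measurable.
Proof.
move=> rv A [B mB <-]; rewrite setTI.
have := measurableT_comp (borelTM_fst HS (x0 := x0)) (random_tangent_measurable rv).
by move=> /(_ measurableT B mB); rewrite setTI.
Qed.

Variable W : M -> 'rV[R]_n.
Hypothesis mW : @measurable_fun _ _ (borelTM S x0) R setT
  (fun yv => inner S yv.1 yv.2 (W yv.1)).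

Lemma component_measurable (v : Omega -> 'rV[R]_n) : random_tangent S x v ->
  measurable_fun setT (fun w => inner S (x w) (v w) (W (x w))).
Proof.
by move=> rv; exact: (measurableT_comp mW (random_tangent_measurable rv)).
Qed.

(** A bounded function of the component along [W] is a bounded Borel function on
    the tangent bundle. *)
Lemma component_cond_indep m (gs : nat -> Omega -> 'rV[R]_n) :
  cond_independent P S m x gs ->
  cond_indep_family P (sigma_of x)
    (fun (i : 'I_m) w => inner S (x w) (gs i w) (W (x w))).
Proof.
move=> ind phi mphi bphi.
apply: (ind (fun i yv => phi i (inner S yv.1 yv.2 (W yv.1)))) => i; split.
  move=> Y mY; have := measurableT_comp (mphi i) mW.
  by move=> /(_ measurableT Y mY); rewrite setTI.
by have [K phiK] := bphi i; exists K.
Qed.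

End RandomTangents.

Section Step.
Context (R : realType) (n : nat) (M : topologicalType).
Variable S : riemannianData R n M.
Hypothesis HS : C1_riemannian S.
Variable F : M -> 'rV[R]_n.
Context d (Omega : measurableType d) (P : probability Omega R).
Variables (x : Omega -> M) (g : Omega -> 'rV[R]_n) (m : nat) (sigma : R).
Hypotheses (m1 : (1 <= m)%N) (rF : random_tangent S x (fun w => F (x w))).

(** [stochastic_oracle] at one time. *)
Definition minibatch_oracle : Prop := exists gs : nat -> Omega -> 'rV[R]_n,
  [/\ (forall i, (i < m)%N -> random_tangent S x (gs i)),
      (forall i, (i < m)%N -> unbiased P S F x (gs i)),
      (forall i, (i < m)%N -> variance_le P S F x (gs i) sigma),
      cond_independent P S m x gs &
      (forall w, g w = m%:R^-1 *: \sum_(i < m) gs i w)].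

Variable W : 'I_n -> M -> 'rV[R]_n.
Hypotheses (bW : forall k, borel_field S (W k))
  (W1 : forall k y, norm S y (W k y) <= 1)
  (WE : forall y v w, inner S y v w =
        \sum_k inner S y v (W k y) * inner S y w (W k y)).
Variable x0 : M.
Hypothesis mW : forall k, @measurable_fun _ _ (borelTM S x0) R setT
  (fun yv => inner S yv.1 yv.2 (W k yv.1)).

Definition frame_coord (v : Omega -> 'rV[R]_n) k w := inner S (x w) (v w) (W k (x w)).

Lemma normsq_frame_coord (v : Omega -> 'rV[R]_n) w :
  normsq S (x w) (v w) = \sum_k frame_coord v k w ^+ 2.
Proof. by rewrite /normsq WE; apply: eq_bigr => k _; rewrite expr2. Qed.

Let Fx w := F (x w).

(** Each coordinate along the frame is a real random variable to which the scalar
    theory applies. Unbiasedness makes the coordinates of [F] versions of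
    conditional expectations, hence measurable for the sigma-algebra of the
    position; this is how they become orthogonal to the noise. *)
Lemma minibatch_noise : minibatch_oracle ->
  (forall k, sq_integrable P (frame_coord g k)) ->
  [/\ (forall k, sq_integrable P (frame_coord Fx k)),
      \sum_k \int[P]_w
        (frame_coord Fx k w * (frame_coord g k w - frame_coord Fx k w)) = 0 &
      \sum_k \int[P]_w ((frame_coord g k w - frame_coord Fx k w) ^+ 2)
        <= sigma ^+ 2 / m%:R].
Proof.
move=> [gs [rgs ub var ind gE]] sg.
have sigG := sigma_of_sigma_algebra x.
have subG := sigma_of_measurable HS x0 rF.
pose X (i : 'I_m) k := frame_coord (gs i) k.
have XF i k : condexp P (sigma_of x) (X i k) (frame_coord Fx k).
  by apply: ub.
have mX i k : measurable_fun setT (X i k).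
  by apply: (component_measurable (mW k)); exact: rgs.
have mF k : measurable_fun setT (frame_coord Fx k).
  by apply: (component_measurable (mW k)).
have XFE (i : 'I_m) w : normsq S (x w) (gs i w - F (x w)) =
    \sum_k (X i k w - frame_coord Fx k w) ^+ 2.
  rewrite (normsq_frame_coord (fun w => gs i w - F (x w))).
  by apply: eq_bigr => k _; rewrite /X /frame_coord innerBl.
have iXF i : integrableR P (fun w => \sum_k (X i k w - frame_coord Fx k w) ^+ 2).
  have [V [iV _ _ _] _] := var i (ltn_ord i).
  by move: iV; rewrite /integrableR; under eq_fun do rewrite XFE.
have sXF i k : sq_integrable P (fun w => X i k w - frame_coord Fx k w).
  apply: (sq_integrable_summand (h := fun k w => X i k w - frame_coord Fx k w)) => //.
  by move=> l; exact: measurable_funB.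
have vXF i : \sum_k \int[P]_w ((X i k w - frame_coord Fx k w) ^+ 2) <= sigma ^+ 2.
  have [V cV Vle] := var i (ltn_ord i).
  have [_ iV] := condexp_integrableR cV.
  apply: le_trans (Rintegral_le_ae iV Vle).
  rewrite -Rintegral_sum; last by move=> k; case: (sXF i k).
  case: cV => _ _ _ /(_ setT) VE; rewrite /Rintegral VE; last first.
    exists setT; last by rewrite setTI preimage_setT.
    by apply: sub_sigma_algebra; exact: openT.
  by under [in leRHS]eq_integral do rewrite XFE.
have gkE k w : frame_coord g k w - frame_coord Fx k w =
    m%:R^-1 * \sum_(i < m) (X i k w - frame_coord Fx k w).
  rewrite /frame_coord gE innerZl inner_suml sumrB mulrBr sumr_const card_ord.
  rewrite -[inner _ _ _ _ *+ m]mulr_natl mulKf// pnatr_eq0 -lt0n//.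
have sxi k : sq_integrable P (fun w => frame_coord g k w - frame_coord Fx k w).
  under eq_fun do rewrite gkE.
  by apply: sq_integrableZ; exact: sq_integrable_sum.
have sF k : sq_integrable P (frame_coord Fx k).
  have := sq_integrableB (sg k) (sxi k).
  by under eq_fun do rewrite opprB addrCA subrr addr0.
have indX k := component_cond_indep (mW k) ind.
split => //.
  rewrite big1// => k _; under eq_Rintegral do rewrite gkE.
  exact: (average_noise_orthogonal sigG subG XF sXF sF).
under eq_bigr do under eq_Rintegral do rewrite gkE.
exact: (average_noise_le sigG subG m1 XF sXF sF indX vXF).
Qed.

(** The hypotheses on the ratios make the step and the operator difference square
    integrable: an infinite expectation would make a ratio vanish. It remains to
    pass to coordinates along the frame and apply [descent]. *)
Lemma expected_descent (y : Omega -> M) (u : Omega -> 'rV[R]_n)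
    (eta muh ellh : R) :
  let ip := inner S in
  let nsq := normsq S in
  let E (X : Omega -> R) : R := fine 'E_P[X]%E in
  let corr := E (fun w => ip (x w) (u w - F (x w)) (- eta *: g w)) in
  let step2 := E (fun w => nsq (x w) (eta *: g w)) in
  let diff2 := E (fun w => nsq (x w) (u w - F (x w))) in
  random_tangent S x u ->
  (forall w, exists gamma : R -> M,
     [/\ exp_curve S (x w) (- eta *: g w) gamma, gamma 1 = y w &
         transport S gamma (F (y w)) (u w)]) ->
  (forall w, g w = F (x w)) /\ sigma = 0 \/ minibatch_oracle ->
  0 < eta < 2 * muh / ellh ^+ 2 ->
  0 < muh -> muh <= corr / step2 ->
  corr / step2 <= Num.sqrt (diff2 / step2) ->
  Num.sqrt (diff2 / step2) <= ellh ->
  ('E_P[fun w => nsq (y w) (F (y w))]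
   <= (1 - (2 * eta * muh - (eta * ellh) ^+ 2)
           / (2 - 2 * eta * muh + (eta * ellh) ^+ 2))%:E
      * 'E_P[fun w => nsq (x w) (F (x w))]
      + (4 * sigma ^+ 2
         / (m%:R * eta * (2 * muh - eta * ellh ^+ 2)))%:E)%E.
Proof.
move=> ip nsq E corr step2 diff2 ru steps oracle eta_bd muh0 h1 h2 h3.
have mF k : measurable_fun setT (frame_coord Fx k).
  exact: (component_measurable (mW k)).
have mu k : measurable_fun setT (frame_coord u k).
  exact: (component_measurable (mW k)).
have mg k : measurable_fun setT (frame_coord g k).
  case: oracle => [[gF _]|[gs [rgs _ _ _ gE]]].
    have -> // : frame_coord g k = frame_coord Fx k.
    by apply/funext => w; rewrite /frame_coord gF.
  have -> : frame_coord g k = fun w => m%:R^-1 * \sum_(i < m) frame_coord (gs i) k w.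
    by apply/funext => w; rewrite /frame_coord gE innerZl inner_suml.
  apply: measurable_funM => //; apply: measurable_sum => i.
  by apply: (component_measurable (mW k)); exact: rgs.
have eta0 : 0 < eta by case/andP: eta_bd.
have EE X : E X = \int[P]_w X w by rewrite /E unlock.
have step2E : step2 = \int[P]_w (\sum_k (eta * frame_coord g k w) ^+ 2).
  rewrite /step2 EE; apply: eq_Rintegral => w _.
  rewrite /nsq (normsq_frame_coord (fun w => eta *: g w)).
  by apply: eq_bigr => k _; rewrite /frame_coord innerZl.
have deltaE w : nsq (x w) (u w - F (x w)) =
    \sum_k (frame_coord u k w - frame_coord Fx k w) ^+ 2.
  rewrite /nsq (normsq_frame_coord (fun w => u w - F (x w))).
  by apply: eq_bigr => k _; rewrite /frame_coord innerBl.
have diff2E : diff2 = \int[P]_w (\sum_k (frame_coord u k w - frame_coord Fx k w) ^+ 2).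
  by rewrite /diff2 EE; apply: eq_Rintegral => w _; rewrite deltaE.
have sqsum_ge0 (h : 'I_n -> Omega -> R) w : 0 <= \sum_k h k w ^+ 2.
  by apply: sumr_ge0 => k _; exact: sqr_ge0.
have msqsum (h : 'I_n -> Omega -> R) : (forall k, measurable_fun setT (h k)) ->
    measurable_fun setT (fun w => \sum_k h k w ^+ 2).
  by move=> mh; apply: measurable_sum => k; exact: measurable_funX.
have q0 : 0 < corr / step2 by exact: lt_le_trans muh0 h1.
have step2_neq0 : step2 != 0.
  by apply: contraTneq q0 => ->; rewrite invr0 mulr0 ltxx.
have diff2_neq0 : diff2 != 0.
  apply: contraTneq q0 => d0; rewrite -leNgt (le_trans h2)//.
  by rewrite d0 mul0r sqrtr0.
have seg k : sq_integrable P (fun w => eta * frame_coord g k w).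
  apply: (sq_integrable_summand (h := fun k w => eta * frame_coord g k w)).
    by move=> l; exact: measurable_funM.
  apply: integrableR_fine_neq0 => [|w|]; last by rewrite -step2E.
    by apply: (msqsum (fun k w => eta * frame_coord g k w)) => l; exact: measurable_funM.
  exact: (sqsum_ge0 (fun k w => eta * frame_coord g k w)).
have sg k : sq_integrable P (frame_coord g k).
  have := sq_integrableZ eta^-1 (seg k).
  by under eq_fun do rewrite mulKf ?gt_eqF//.
have sd k : sq_integrable P (fun w => frame_coord u k w - frame_coord Fx k w).
  apply: (sq_integrable_summand (h := fun k w => frame_coord u k w - frame_coord Fx k w)).
    by move=> l; exact: measurable_funB.
  apply: integrableR_fine_neq0 => [|w|]; last by rewrite -diff2E.
    apply: (msqsum (fun k w => frame_coord u k w - frame_coord Fx k w)) => l.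
    exact: measurable_funB.
  exact: (sqsum_ge0 (fun k w => frame_coord u k w - frame_coord Fx k w)).
have [sF orth noise] : [/\ (forall k, sq_integrable P (frame_coord Fx k)),
      \sum_k \int[P]_w
        (frame_coord Fx k w * (frame_coord g k w - frame_coord Fx k w)) = 0 &
      \sum_k \int[P]_w ((frame_coord g k w - frame_coord Fx k w) ^+ 2)
        <= sigma ^+ 2 / m%:R].
  case: oracle => [[gF s0]|mb]; last exact: minibatch_noise.
  have gFk k : frame_coord g k = frame_coord Fx k.
    by apply/funext => w; rewrite /frame_coord gF.
  split.
  - by move=> k; rewrite -gFk.
  - rewrite big1// => k _; under eq_Rintegral do rewrite gFk subrr mulr0.
    by rewrite Rintegral_cst// mul0r.
  - rewrite s0 expr0n/= mul0r big1// => k _.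
    under eq_Rintegral do rewrite gFk subrr expr0n.
    by rewrite Rintegral_cst// mul0r.
have su k : sq_integrable P (frame_coord u k).
  have := sq_integrableD (sd k) (sF k).
  by under eq_fun do rewrite subrK.
pose B (a b : 'I_n -> Omega -> R) := \sum_k \int[P]_w (a k w * b k w).
have step2B : step2 = eta ^+ 2 * B (frame_coord g) (frame_coord g).
  rewrite step2E Rintegral_sum; last by move=> k; case: (seg k).
  rewrite mulr_sumr; apply: eq_bigr => k _.
  rewrite -RintegralZl//; last exact: sq_integrableM.
  by apply: eq_Rintegral => w _; ring.
have corrB : corr = - eta *
    B (fun k w => frame_coord u k w - frame_coord Fx k w) (frame_coord g).
  rewrite /corr EE /B mulr_sumr.
  transitivity (\int[P]_w (\sum_k
      - eta * ((frame_coord u k w - frame_coord Fx k w) * frame_coord g k w))).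
    apply: eq_Rintegral => w _; rewrite /ip WE; apply: eq_bigr => k _.
    by rewrite /frame_coord innerBl innerZl; ring.
  rewrite Rintegral_sum => [|k]; last by apply: integrableRZ; exact: sq_integrableM.
  apply: eq_bigr => k _; rewrite RintegralZl//.
  exact: sq_integrableM.
have diff2B : diff2 = B (fun k w => frame_coord u k w - frame_coord Fx k w)
    (fun k w => frame_coord u k w - frame_coord Fx k w).
  rewrite diff2E Rintegral_sum; last by move=> k; case: (sd k).
  by apply: eq_bigr => k _; apply: eq_Rintegral => w _; rewrite expr2.
have step20 : 0 < step2.
  rewrite lt_neqAle eq_sym step2_neq0 step2E Rintegral_ge0// => w _.
  exact: (sqsum_ge0 (fun k w => eta * frame_coord g k w)).
have noise' : B (fun k w => frame_coord g k w - frame_coord Fx k w)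
    (fun k w => frame_coord g k w - frame_coord Fx k w) <= sigma ^+ 2 / m%:R.
  apply: le_trans noise; rewrite le_eqVlt; apply/orP; left; apply/eqP.
  by apply: eq_bigr => k _; apply: eq_Rintegral => w _; rewrite expr2.
have := descent su sg sF eta_bd muh0.
rewrite -/(B _ _) -corrB -/(B _ _) -step2B -/(B _ _) -diff2B.
move=> /(_ _ h1 h2 h3 step20 orth noise') main.
have sqE (v : Omega -> 'rV[R]_n) : (forall k, sq_integrable P (frame_coord v k)) ->
    ('E_P[fun w => nsq (x w) (v w)] = (B (frame_coord v) (frame_coord v))%:E)%E.
  move=> sv; rewrite unlock /B -integral_sq_sum//.
  apply: eq_integral => w _; rewrite /nsq normsq_frame_coord.
  by congr EFin; apply: eq_bigr => k _; rewrite expr2.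
have isom w : nsq (y w) (F (y w)) = nsq (x w) (u w).
  have [gamma [[geo g0 _] g1 tr]] := steps w.
  by have := transport_isometry HS geo tr; rewrite g0 g1.
under [X in ('E_P[X] <= _)%E]eq_fun do rewrite isom.
rewrite (sqE u)// (sqE Fx)// -EFinM -EFinD lee_fin.
apply: (le_trans main); rewrite lerD2l le_eqVlt; apply/orP; left; apply/eqP.
by rewrite -!mulrA !invfM; ring.
Qed.
End Step.

Theorem lemma4p2
  (R : realType) (N : nat) (dim : 'I_N -> nat) (M : 'I_N -> topologicalType)
  (S : forall i : 'I_N, riemannianData R (dim i) (M i))
  (L : 'I_N -> prod_topology M -> R)
  (mu ell : R)
  (HS : forall i : 'I_N, riemannian_manifold (S i))
  (Hcomplete : metrically_complete (prod_riemannian S))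
  (HL : differentiable_game S L)
  (Hmu : 0 < mu)
  (Hmonotone :
    strongly_monotone (prod_riemannian S) (game_operator S L) mu)
  (Hsmooth :
    geodesically_smooth (prod_riemannian S) (game_operator S L) ell)
  (d : measure_display) (Omega : measurableType d) (P : probability Omega R)
  (T : nat) (eta : nat -> R) (m : nat -> nat) (sigma : R)
  (Heta : forall t : nat, (t < T)%N -> 0 < eta t)
  (Hm : forall t : nat, (t < T)%N -> (1 <= m t)%N)
  (x0 : prod_topology M)
  (g : nat -> Omega -> 'rV[R]_(\sum_i dim i))
  (x : nat -> Omega -> prod_topology M)
  (u : nat -> Omega -> 'rV[R]_(\sum_i dim i))
  (Hrun :
    rgd_run (prod_riemannian S) (game_operator S L) T x0 eta g x u)
  (Hsetting :
    (deterministic_oracle (game_operator S L) T x g /\ sigma = 0) \/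
    (stochastic_oracle P (prod_riemannian S) (game_operator S L) T m sigma x g
     /\ exists (xstar : prod_topology M) (B : R),
          nash_equilibrium L xstar /\
          (rdist (prod_riemannian S) x0 xstar <= B%:E)%E))
  (t : nat) (Ht : (t < T)%N) (muh ellh : R)
  (Hstep : 0 < eta t < 2 * muh / ellh ^+ 2) :
  let F := game_operator S L in
  let ip := inner (prod_riemannian S) in
  let nsq := normsq (prod_riemannian S) in
  let E (X : Omega -> R) : R := fine 'E_P[X]%E in
  let corr := E (fun w => ip (x t w) (u t w - F (x t w)) (- eta t *: g t w)) in
  let step2 := E (fun w => nsq (x t w) (eta t *: g t w)) in
  let diff2 := E (fun w => nsq (x t w) (u t w - F (x t w))) in
  0 < muh ->
  muh <= corr / step2 ->
  corr / step2 <= Num.sqrt (diff2 / step2) ->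
  Num.sqrt (diff2 / step2) <= ellh ->
  ('E_P[fun w => nsq (x t.+1 w) (F (x t.+1 w))]
   <= (1 - (2 * eta t * muh - (eta t * ellh) ^+ 2)
           / (2 - 2 * eta t * muh + (eta t * ellh) ^+ 2))%:E
      * 'E_P[fun w => nsq (x t w) (F (x t w))]
      + (4 * sigma ^+ 2
         / ((m t)%:R * eta t * (2 * muh - eta t * ellh ^+ 2)))%:E)%E.
Proof.
move=> F ip nsq E corr step2 diff2 muh0 h1 h2 h3.
have HM := prod_riemannian_C1 (fun i => riemannian_manifold_C1 (HS i)).
have [W [bW W1 WE mW]] := borel_frame HM x0.
have [rF ru _ steps] := Hrun.
apply: (expected_descent (S := prod_riemannian S) HM (Hm t Ht)
  (rF t (ltnW Ht)) bW W1 WE mW (ru t Ht) _ _ Hstep muh0 h1 h2 h3).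
  by move=> w; exact: steps t w Ht.
case: Hsetting => [[det s0]|[[gs gsP] _]].
  by left; split => // w; exact: det.
by right; exists (gs t); exact: gsP t Ht.
Qed.
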